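(* Let $\Sigma=\{1,\dots,k\}$ be a finite alphabet and let $\sigma\colon\Sigma^{\mathbb{N}}\to\Sigma^{\mathbb{N}}$ be the left-sided full shift. Fix a continuous function $\psi\in Hof\cap\widetilde{WB}$. Then $\psi$ admits a weak Gibbs measure $\nu$ on $\Sigma^{\mathbb{N}}$ (not necessarily invariant). Put $f_n(x)=\log\nu(C_{i_1\ldots i_n}(x))$ for $x\in\Sigma^{\mathbb{N}}$ and $n\in\mathbb{N}$. (a) The sequence $\mathcal{G}=(f_n+nP_\sigma(\psi))_{n\in\mathbb{N}}$ is asymptotically additive, is physically equivalent to $(S_n\psi)_{n\in\mathbb{N}}$, has a unique equilibrium measure, satisfies the Walters property (and hence has bounded variation), and is not physically equivalent to any additive sequence generated by a Bowen function (in particular, not to any additive sequence generated by a locally constant function). (b) For each $\alpha>0$ there exists a sequence $\mathcal{H}_\alpha=(h_n^\alpha)_{n\in\mathbb{N}}$ of Hölder continuous functions on $\Sigma^{\mathbb{N}}$ such that $\|h_n^\alpha-f_n-nP_\sigma(\psi)\|_\infty\le\alpha$ for all $n\in\mathbb{N}$. Each $\mathcal{H}_\alpha$ is asymptotically additive, has bounded variation, satisfies $\lim_{n\to\infty}\frac1n\|h_n^\alpha-S_n\psi\|_\infty=0$, and admits a unique equilibrium measure, but is not physically equivalent to any additive sequence generated by a Bowen function (in particular, not to any additive sequence generated by a Hölder continuous function). Consequently, it is not true that every asymptotically additive sequence (with respect to $\sigma$) of (Hölder) continuous functions with bounded variation and a unique equilibrium measure is physically equivalent to $(S_nf)_{n\in\mathbb{N}}$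 for some Bowen (or Hölder) continuous function $f$.
   Context: $\mathbb{N}=\{1,2,\dots\}$. $\Sigma^{\mathbb{N}}$ is the space of sequences $x=(i_1i_2\cdots)$ with $i_n\in\Sigma$, with the usual metric (e.g. $d(x,y)=2^{-\min\{n:x_n\ne y_n\}}$ for $x\ne y$), and $\sigma(i_1i_2i_3\cdots)=(i_2i_3\cdots)$. For $x=(i_1i_2\cdots)$, $C_{i_1\ldots i_n}(x)$ is the cylinder of all $(j_1j_2\cdots)$ with $j_1=i_1,\dots,j_n=i_n$. $S_nf=\sum_{j=0}^{n-1}f\circ\sigma^j$; $\|\cdot\|_\infty$ is the supremum norm; $\mathcal{M}_\sigma$ is the set of $\sigma$-invariant probability measures; $C(\Sigma^{\mathbb{N}})$ is the space of continuous real functions on $\Sigma^{\mathbb{N}}$. Asymptotically additive: $(f_n)_{n\in\mathbb N}$ is asymptotically additive if for each $\varepsilon>0$ there is a function $f$ with $\limsup_{n\to\infty}\frac1n\|f_n-S_nf\|_\infty<\varepsilon$ (for continuous $f_n$, $f$ can be taken continuous). Bounded variation: there is $\varepsilon>0$ with $\sup_{n}\sup\{|f_n(x)-f_n(y)|: d(\sigma^j(x),\sigma^j(y))<\varepsilon\text{ for }0\le j\le n-1\}<\infty$. A function $f$ is Bowen if $(S_nf)_{n\in\mathbb{N}}$ has bounded variation; $Bow$ is the space of continuous Bowen functions. Walters property: for each $\kappa>0$ there is $\varepsilon>0$ such that, for all $x,y$ and $n$, $d(\sigma^j(x),\sigma^j(y))<\varepsilon$ for $0\le j\le n-1$ implies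 $|f_n(x)-f_n(y)|<\kappa$. Physically equivalent: $(f_n)_{n\in\mathbb N}$ and $(g_n)_{n\in\mathbb N}$ are physically equivalent if $\lim_{n\to\infty}\frac1n\|f_n-g_n\|_\infty=0$. Pressure and equilibrium measure: for an asymptotically additive sequence $\mathcal{F}=(f_n)_{n\in\mathbb N}$ of continuous functions, $P_\sigma(\mathcal{F})=\sup_{\mu\in\mathcal{M}_\sigma}\big(h_\mu(\sigma)+\lim_{n\to\infty}\frac1n\int f_n\,d\mu\big)$, where $h_\mu(\sigma)$ is the Kolmogorov–Sinai entropy; an equilibrium measure is a $\mu\in\mathcal{M}_\sigma$ attaining this supremum. For a continuous function $\psi$, $P_\sigma(\psi)$ is the classical topological pressure, i.e. the pressure of $(S_n\psi)_{n\in\mathbb N}$, and equilibrium measures of $\psi$ are those of $(S_n\psi)_{n\in\mathbb N}$. Weak Gibbs: a measure $\nu$ is weak Gibbs with respect to $\psi$ if there is a sequence $(K_n)_{n\in\mathbb N}\subset[1,\infty)$ with $\lim_{n\to\infty}\frac1n\log K_n=0$ and $K_n^{-1}\le\frac{\nu(C_{i_1\ldots i_n}(x))}{\exp(-nP_\sigma(\psi)+S_n\psi(x))}\le K_n$ for all $x\in\Sigma^{\mathbb{N}}$ and $n\ge1$. Function classes: a coboundary is a function $q\circ\sigma-q$ with $q$ continuous; $Wcob$ is the space of weak coboundaries, i.e. uniform limits of coboundaries. $WB=Wcob+Bow$, and $\widetilde{WB}$ is the complement of $WB$ in $C(\Sigma^{\mathbb{N}})$. $Hof$ (Hofbauer functions)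 is the set of continuous functions that are not Bowen but have a unique equilibrium measure. *)

(* Defs.v *)
From HB Require Import structures.
From mathcomp Require Import all_boot all_order all_algebra.
From mathcomp Require Import all_classical all_reals all_analysis.
Set Implicit Arguments.
Unset Strict Implicit.
Unset Printing Implicit Defensive.
Import Order.TTheory GRing.Theory Num.Theory.
Import numFieldNormedType.Exports.
Local Open Scope classical_set_scope.
Local Open Scope ring_scope.

(* One-sided sequences over an alphabet of k.+1 >= 1 symbols.  The coordinate
   i_n of x = (i_1 i_2 ...) is [x n.-1].  The parameter R is a phantom that
   lets the R-valued metric below be a canonical structure. *)
Definition fullshift (R : realType) (k : nat) : Type := nat -> 'I_k.+1.

HB.instance Definition _ (R : realType) (k : nat) :=
  Choice.copy (fullshift R k) (nat -> 'I_k.+1).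
HB.instance Definition _ (R : realType) (k : nat) :=
  isPointed.Build (fullshift R k) (fun=> ord0).

Section metric.
Context (R : realType) (k : nat).
Implicit Types x y z : fullshift R k.

(* 2 ^ - min {n >= 1 : i_n <> j_n}; the exponent is shifted by one because
   coordinates are numbered from 0 here. *)
Definition shift_dist x y : R :=
  if pselect (exists n, x n != y n) is left xy then 2 ^- (ex_minn xy).+1
  else 0.

Lemma shift_distP x y n :
  (shift_dist x y < 2 ^- n) <-> (forall j, (j < n)%N -> x j = y j).
Proof.
rewrite /shift_dist; case: pselect => [xy|xy]; last first.
  split=> [_ j _|_]; last by rewrite invr_gt0 exprn_gt0.
  by apply/eqP/negPn/negP => xyj; apply: xy; exists j.
case: ex_minnP => m xym mmin.
have -> : (2 ^- m.+1 < 2 ^- n :> R) = (n < m.+1)%N.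
  by rewrite ltf_pV2 ?posrE ?exprn_gt0// ltr_eXn2l// ltr1n.
rewrite ltnS; split=> [nm j jn|xyE].
  apply/eqP/negPn/negP => /mmin mj.
  by have := leq_trans (leq_ltn_trans mj jn) nm; rewrite ltnn.
by rewrite leqNgt; apply/negP => /xyE/eqP; apply/negP.
Qed.

Let shift_dist_ge0 x y : 0 <= shift_dist x y.
Proof.
by rewrite /shift_dist; case: pselect => // xy; rewrite invr_ge0 exprn_ge0.
Qed.

Let shift_distxx x : shift_dist x x = 0.
Proof.
rewrite /shift_dist; case: pselect => // xx.
by exfalso; case: xx => n; rewrite eqxx.
Qed.

Let shift_dist_positivity x y : shift_dist x y = 0 -> x = y.
Proof.
move=> xy0; apply/funext => n.
have /shift_distP : shift_dist x y < 2 ^- n.+1.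
  by rewrite xy0 invr_gt0 exprn_gt0.
exact.
Qed.

Let shift_dist_sym x y : shift_dist x y = shift_dist y x.
Proof.
rewrite /shift_dist; case: pselect => [xy|xy]; case: pselect => [yx|yx] //.
- case: ex_minnP => m xym mmin; case: ex_minnP => p yxp pmin.
  suff -> : m = p by [].
  apply/eqP; rewrite eqn_leq mmin 1?eq_sym//= pmin//.
  by rewrite eq_sym.
- by exfalso; apply: yx; case: xy => n; exists n; rewrite eq_sym.
- by exfalso; apply: xy; case: yx => n; exists n; rewrite eq_sym.
Qed.

Let shift_dist_triangle y x z :
  shift_dist x z <= shift_dist x y + shift_dist y z.
Proof.
rewrite {1}/shift_dist; case: pselect => [xz|_]; last exact: addr_ge0.
case: ex_minnP => m xzm _.
have [lt_xy|le_xy] := ltP (shift_dist x y) (2 ^- m.+1); last first.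
  by rewrite -[leLHS]addr0 lerD.
have [lt_yz|le_yz] := ltP (shift_dist y z) (2 ^- m.+1); last first.
  by rewrite -[leLHS]add0r lerD.
move/shift_distP: lt_xy => /(_ m (ltnSn m)) xy.
move/shift_distP: lt_yz => /(_ m (ltnSn m)) yz.
by move: xzm; rewrite xy yz eqxx.
Qed.

HB.instance Definition _ := isMetric.Build R (fullshift R k)
  shift_distxx shift_dist_positivity shift_dist_sym shift_dist_triangle.

End metric.

(* The Borel sigma-algebra. *)
HB.instance Definition _ (R : realType) (k : nat) :=
  Measurable.copy (fullshift R k)
    (g_sigma_algebraType (@open (fullshift R k))).

Section thermodynamic_formalism.
Context (R : realType) (k : nat).
Local Notation X := (fullshift R k).
Implicit Types (f g psi : X -> R) (F G : nat -> X -> R).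

Definition left_shift (x : X) : X := fun n => x n.+1.

(* [cylinder x n] is C_{i_1...i_n}(x). *)
Definition cylinder (x : X) (n : nat) : set X :=
  [set y : X | forall j, (j < n)%N -> y j = x j].

Definition birkhoff f (n : nat) (x : X) : R :=
  \sum_(j < n) f (iter j left_shift x).

(* Extended-valued, because some of the functions it is applied to are not
   assumed bounded. *)
Definition supnorm f : \bar R := ereal_sup [set `|f x|%:E | x in [set: X]].

(* A sequence (f_n)_{n >= 1} is a function F : nat -> X -> R whose term F 0 is
   irrelevant: every property below only depends on the F n with n >= 1. *)

Definition asymptotically_additive F : Prop :=
  forall e : R, 0 < e -> exists f,
    (limn_esup (fun n => n%:R^-1%:E * supnorm (F n \- birkhoff f n)%R) < e%:E)%E.

Definition has_bounded_variation F : Prop :=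
  exists2 e : R, 0 < e & exists C : R, forall n (x y : X), (0 < n)%N ->
    (forall j, (j < n)%N ->
       mdist (iter j left_shift x) (iter j left_shift y) < e) ->
    `|F n x - F n y| <= C.

Definition walters F : Prop :=
  forall kappa : R, 0 < kappa -> exists2 e : R, 0 < e &
    forall n (x y : X), (0 < n)%N ->
    (forall j, (j < n)%N ->
       mdist (iter j left_shift x) (iter j left_shift y) < e) ->
    `|F n x - F n y| < kappa.

Definition physically_equivalent F G : Prop :=
  (fun n => n%:R^-1%:E * supnorm (F n \- G n)%R)%E @ \oo --> 0%E.

Definition holder_continuous f : Prop :=
  exists C a : R, [/\ 0 <= C, 0 < a, a <= 1 &
    forall x y : X, `|f x - f y| <= C * mdist x y `^ a].

Definition locally_constant f : Prop :=
  forall x : X, \forall y \near x, f y = f x.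

Definition bowen f : Prop := has_bounded_variation (birkhoff f).

Definition Bow : set (X -> R) := [set f | continuous f /\ bowen f].

Definition coboundary (q : X -> R) (x : X) : R := q (left_shift x) - q x.

Definition Wcob : set (X -> R) :=
  [set u | exists2 q : nat -> X -> R, forall n, continuous (q n) &
     supnorm (u \- coboundary (q n)) @[n --> \oo] --> 0%E].

Definition WB : set (X -> R) :=
  [set f | exists u b, [/\ Wcob u, Bow b & f = u \+ b]].

Definition coWB : set (X -> R) := [set f | continuous f] `\` WB.

Definition shift_invariant (mu : probability X R) : Prop :=
  forall A : set X, measurable A -> mu (left_shift @^-1` A) = mu A.

Definition measurable_partition m (P : 'I_m -> set X) : Prop :=
  [/\ forall i, measurable (P i), trivIset setT P & \bigcup_i P i = setT].

(* The atoms of the join of P, left_shift^-1 P, ..., left_shift^-(n-1) P. *)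
Definition join_atom m (P : 'I_m -> set X) n (w : {ffun 'I_n -> 'I_m}) :
    set X :=
  \bigcap_(j : 'I_n) ((fun x : X => iter j left_shift x) @^-1` P (w j)).

Definition join_entropy (mu : probability X R) m (P : 'I_m -> set X)
    (n : nat) : R :=
  - \sum_(w : {ffun 'I_n -> 'I_m})
      fine (mu (join_atom P w)) * ln (fine (mu (join_atom P w))).

Definition partition_entropy (mu : probability X R) m (P : 'I_m -> set X) : R :=
  limn (fun n => n%:R^-1 * join_entropy mu P n).

Definition ks_entropy (mu : probability X R) : \bar R :=
  ereal_sup [set h | exists m (P : 'I_m -> set X),
    measurable_partition P /\ h = (partition_entropy mu P)%:E].

(* Pressure and equilibrium measures; meaningful for asymptotically additive
   sequences of continuous functions, for which the limit exists. *)

Definition free_energy F (mu : probability X R) : \bar R :=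
  (ks_entropy mu
   + limn (fun n => n%:R^-1%:E * \int[mu]_x (F n x)%:E))%E.

Definition pressure F : \bar R :=
  ereal_sup [set free_energy F mu | mu in shift_invariant].

Definition equilibrium_measure F (mu : probability X R) : Prop :=
  shift_invariant mu /\ free_energy F mu = pressure F.

(* Measures are functions on all sets, with unconstrained values outside the
   sigma-algebra: two of them are identified when they agree on measurable
   sets. *)
Definition unique_equilibrium_measure F : Prop :=
  exists2 mu, equilibrium_measure F mu &
    forall mu', equilibrium_measure F mu' ->
      forall A : set X, measurable A -> mu' A = mu A.

Definition Hof : set (X -> R) :=
  [set f | [/\ continuous f, ~ bowen f &
              unique_equilibrium_measure (birkhoff f)]].

(* The pressure of a continuous function is finite, hence [fine]. *)
Definition top_pressure psi : R := fine (pressure (birkhoff psi)).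

Definition weak_gibbs psi (nu : probability X R) : Prop :=
  exists K : nat -> R,
    [/\ forall n, (0 < n)%N -> 1 <= K n,
        n%:R^-1 * ln (K n) @[n --> \oo] --> 0 &
        forall (x : X) n, (0 < n)%N ->
          (K n)^-1 <= fine (nu (cylinder x n))
                      / expR (- (n%:R * top_pressure psi) + birkhoff psi n x)
                   <= K n].

End thermodynamic_formalism.

Arguments Bow {R k} _.
Arguments coWB {R k} _.
Arguments Hof {R k} _.
Arguments holder_continuous {R k} f.
Arguments shift_invariant {R k} mu.

(* Main.v *)
(* Write a_L for the logarithm of the sum, over the words w of length L, of
   exp (S_L psi (w 0 0 ...)).  Drawing consecutive blocks independently, a block w
   of length L having probability exp (S_L psi (w 0 0 ...) - a_L), gives a measure
   whose cylinders satisfy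
     ln nu (C_n x) = S_n psi x - (sum of the a_L over the blocks) + error,
   where each block contributes an error o(L) by uniform continuity of psi.

   - Blocks of constant length L bound the pressure P on both sides:
     |a_L - L P| = o(L).  Gibbs' inequality against this block measure bounds
     h_mu + int psi dmu from above for every invariant mu, and averaging the block
     measure over L shifts gives an invariant measure attaining the lower bound.
   - Blocks of lengths 1, 2, 3, ... then give a weak Gibbs measure with the constant
     P; no eigenmeasure of a transfer operator is needed.

   The function G_n = ln nu (C_n) + n P is constant on cylinders of length n, so it is
   Hoelder, Walters and of bounded variation, and H_alpha = G serves for every alpha.
   If G were equivalent to (S_n phi), then |S_n (psi - phi)| / n would tend to 0
   uniformly, and psi - phi, being the sum of S_n (psi - phi) / n and a coboundary,
   would be a weak coboundary; a Bowen phi would put psi in WB. *)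

Require Import Defs.
From HB Require Import structures.
From mathcomp Require Import all_boot all_order all_algebra.
From mathcomp Require Import all_classical all_reals all_analysis.
From mathcomp Require Import measurable_realfun.
From mathcomp Require Import ring lra.
Import Order.TTheory GRing.Theory Num.Theory.
Import numFieldNormedType.Exports.
Local Open Scope classical_set_scope.
Local Open Scope ring_scope.
Set Implicit Arguments.
Unset Strict Implicit.
Unset Printing Implicit Defensive.

(** * Topology of the full shift *)

Section topology.
Context (R : realType) (k : nat).
Local Notation A := 'I_k.+1.
Local Notation X := (fullshift R k).

Definition hat (w : seq A) : X := fun i => nth ord0 w i.

(** A rule [d] choosing the next letter from the prefix already built defines the point [stream d];
    this serves both for the bad branch in [konig] and for the digits of a real number. *)
Fixpoint walk (d : seq A -> A) n : seq A :=
  if n is m.+1 then rcons (walk d m) (d (walk d m)) else [::].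

Definition stream (d : seq A -> A) : X := fun n => d (walk d n).

Lemma walkE d n : walk d n = mkseq (stream d) n.
Proof. by elim: n => // n IH; rewrite mkseqS -IH. Qed.

Lemma mkseq_cylinder (x y : X) n : cylinder x n y <-> mkseq y n = mkseq x n.
Proof.
split=> [xy|xy j jn].
  by apply/eq_in_map => j; rewrite mem_iota => /andP[_ jn]; rewrite xy.
by rewrite -(nth_mkseq ord0 y jn) xy nth_mkseq.
Qed.

Lemma mkseq_hat (w : seq A) : mkseq (hat w) (size w) = w.
Proof. exact: mkseq_nth. Qed.

Lemma mkseqD (x : X) m n :
  mkseq x (m + n) = mkseq x m ++ mkseq (iter m (@left_shift R k) x) n.
Proof.
rewrite /mkseq iotaD map_cat add0n; congr cat.
rewrite -[m in iota m n]addn0 iotaDl -map_comp; apply: eq_map => i /=.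
by elim: m x i => // m IH x i; rewrite iterSr addSn -IH.
Qed.

Lemma iter_shift (x : X) m n : iter m (@left_shift R k) x n = x (m + n)%N.
Proof. by elim: m x => // m IH x; rewrite iterSr IH. Qed.

Lemma cylinder_sub (x y : X) m n : (m <= n)%N -> cylinder x m y ->
  cylinder y n `<=` cylinder x m.
Proof. by move=> mn xy z yz j jm; rewrite yz ?xy// (leq_trans jm). Qed.

Lemma cylinder_shift (x y : X) m n j : cylinder x n y -> (j + m <= n)%N ->
  cylinder (iter j (@left_shift R k) x) m (iter j (@left_shift R k) y).
Proof.
move=> xy jmn i im; rewrite !iter_shift xy//.
by rewrite (leq_trans _ jmn)// ltn_add2l.
Qed.

Lemma mdist_lt_cylinder (x y : X) n : (mdist x y < 2 ^- n :> R) <-> cylinder x n y.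
Proof.
split; first by move=> /shift_distP xy j jn; rewrite xy.
by move=> xy; apply/shift_distP => j jn; rewrite xy.
Qed.

Lemma exists_expN2_lt (e : R) : 0 < e -> exists n, 2 ^- n < e.
Proof.
move=> e0; exists (Num.bound e^-1).
rewrite invf_plt ?posrE ?exprn_gt0//.
rewrite (lt_trans (archi_boundP _)) ?invr_ge0 ?ltW//.
by rewrite -natrX ltr_nat ltn_expl.
Qed.

Lemma nbhs_cylinderP (x : X) (U : set X) :
  nbhs x U <-> exists n, cylinder x n `<=` U.
Proof.
split=> [/nbhs_ballP[e /= e0 eU]|[n nU]].
  have [n ne] := exists_expN2_lt e0; exists n => y /mdist_lt_cylinder xy.
  by apply: eU; rewrite ballEmdist/=; apply: lt_trans ne.
apply/nbhs_ballP; exists (2 ^- n); first by rewrite /= invr_gt0 exprn_gt0.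
by move=> y; rewrite ballEmdist/= => /mdist_lt_cylinder; exact: nU.
Qed.

Lemma open_cylinder (x : X) n : open (cylinder x n).
Proof.
rewrite openE => y xy; apply/nbhs_cylinderP; exists n.
exact: cylinder_sub.
Qed.

Lemma continuous_cylinderP (f : X -> R) : continuous f <->
  forall x (e : R), 0 < e -> exists n, forall y, cylinder x n y -> `|f x - f y| < e.
Proof.
split=> [cf x e e0|H x].
  have /cvgrPdist_lt/(_ e e0) := cf x.
  by move=> /nbhs_cylinderP[n xn]; exists n.
move=> U /nbhs_ballP[e /= e0 eU]; apply/nbhs_cylinderP.
have [n xn] := H x e e0; exists n => y xy; apply: eU.
by rewrite -ball_normE/=; exact: xn.
Qed.

Lemma continuous_left_shift : continuous (@left_shift R k).
Proof.
move=> x U /nbhs_cylinderP[n nU]; apply/nbhs_cylinderP; exists n.+1 => y xy.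
by apply: nU => j jn; rewrite /left_shift xy.
Qed.

(* Compactness of the full shift, in the form of Koenig's lemma. *)
Lemma konig (Good : set (set X)) :
  (forall B C, C `<=` B -> Good B -> Good C) ->
  (forall x, exists n, Good (cylinder x n)) ->
  exists N, forall x, Good (cylinder x N).
Proof.
move=> mono cov; apply: contrapT => /forallNP nN.
pose Bad w := forall N, exists y, mkseq y (size w) = w /\ ~ Good (cylinder y N).
have bad0 : Bad [::] by move=> N; have /existsNP[y] := nN N; exists y.
have badS w : Bad w -> exists a, Bad (rcons w a).
  move=> bw; apply: contrapT => /forallNP H.
  have {}H a : exists N, forall y : X, mkseq y (size w).+1 = rcons w a ->
      Good (cylinder y N).
    have /existsNP[N /forallNP nNy] := H a.
    exists N => y yw; apply: contrapT => ng; apply: (nNy y).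
    by rewrite size_rcons.
  (* If no extension of [w] were bad, the largest of the finitely many depths [N a] would contradict
     [bw]. *)
  pose N a := sval (cid (H a)); have [y [yw]] := bw (\max_a N a)%N; apply.
  have := svalP (cid (H (y (size w)))) y.
  rewrite mkseqS yw => /(_ erefl); apply: mono; apply: cylinder_sub => //.
  exact: (leq_bigmax (y (size w))).
pose d w := if pselect (Bad w) is left bw then sval (cid (badS w bw)) else ord0.
have bad n : Bad (walk d n).
  elim: n => //= n IH; rewrite {2}/d; case: pselect => // bw.
  exact: svalP (cid (badS _ bw)).
(* Every prefix of [stream d] is bad, which [cov] contradicts. *)
have [n gn] := cov (stream d); have [y [yn]] := bad n n; apply.
apply: mono gn; apply: cylinder_sub => //; apply/mkseq_cylinder.
by rewrite -walkE -[in RHS]yn walkE size_mkseq.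
Qed.

Lemma uniformly_continuous_cylinder (f : X -> R) : continuous f ->
  forall e : R, 0 < e ->
  exists N, forall x y, cylinder x N y -> `|f x - f y| < e.
Proof.
move=> /continuous_cylinderP cf e e0.
pose Good := [set B : set X | forall x y, B x -> B y -> `|f x - f y| < e].
suff loc : forall x, exists n, Good (cylinder x n).
  have [|N gN] := @konig Good _ loc; last by exists N => x y xy; apply: (gN x).
  by move=> B C CB gB x y Cx Cy; apply: gB; apply: CB.
move=> x; have [n xn] := cf x (e / 2) ltac:(by rewrite divr_gt0).
exists n => y z /xn xy /xn xz.
rewrite (_ : f y - f z = (f y - f x) + (f x - f z)); last by ring.
by rewrite (le_lt_trans (ler_normD _ _))// (splitr e) distrC ltrD// distrC.
Qed.

(** At a suitable depth [N] the values at the finitely many points [hat u] determine the function up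
    to an error 1. *)
Lemma continuous_bounded (f : X -> R) : continuous f ->
  exists2 M : R, 0 <= M & forall x, `|f x| <= M.
Proof.
move=> cf; have [N gN] := uniformly_continuous_cylinder cf ltr01.
exists (\sum_(u : N.-tuple A) `|f (hat u)| + 1).
  by rewrite addr_ge0// sumr_ge0.
move=> x; pose u := [tuple of mkseq x N].
have /gN xu : cylinder x N (hat u).
  by apply/mkseq_cylinder; have := mkseq_hat u; rewrite size_tuple.
rewrite (bigD1 u)//= -addrA [X in _ + X]addrC addrA.
rewrite ler_wpDr ?sumr_ge0//.
rewrite (_ : f x = f (hat u) + (f x - f (hat u))); last by ring.
by rewrite (le_trans (ler_normD _ _))// lerD2l ltW.
Qed.

Lemma locally_constant_cylinder (f : X -> R) : locally_constant f ->
  exists N, forall x y, cylinder x N y -> f x = f y.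
Proof.
move=> lf.
pose Good := [set B : set X | forall x y, B x -> B y -> f x = f y].
suff loc : forall x, exists n, Good (cylinder x n).
  have [|N gN] := @konig Good _ loc; last by exists N => x y xy; apply: (gN x).
  by move=> B C CB gB x y Cx Cy; apply: gB; apply: CB.
move=> x; have /nbhs_cylinderP[n xn] := lf x; exists n => y z /xn fy /xn fz.
by rewrite fy fz.
Qed.

Implicit Types psi : X -> R.

Lemma birkhoffS psi n x :
  birkhoff psi n.+1 x = psi x + birkhoff psi n (left_shift x).
Proof.
by rewrite /birkhoff big_ord_recl; congr (_ + _); apply: eq_bigr => j _; rewrite -iterSr.
Qed.

Lemma birkhoffD psi m n x : birkhoff psi (m + n) x =
  birkhoff psi m x + birkhoff psi n (iter m (@left_shift R k) x).
Proof.
elim: m x => [x|m IH x]; first by rewrite /birkhoff big_ord0 add0r.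
by rewrite addSn !birkhoffS IH addrA -iterSr.
Qed.

Lemma continuous_birkhoff psi n : continuous psi -> continuous (birkhoff psi n).
Proof.
move=> cpsi; elim: n => [|n IH] x.
  rewrite (_ : birkhoff psi 0 = cst 0); first exact: cst_continuous.
  by apply/funext => y; rewrite /birkhoff big_ord0.
rewrite (_ : birkhoff psi n.+1 = psi \+ (birkhoff psi n \o @left_shift R k)); last first.
  by apply/funext => y; rewrite birkhoffS.
apply: (@continuousD _ _ _ psi (birkhoff psi n \o @left_shift R k)); first exact: cpsi.
by apply: continuous_comp; [exact: continuous_left_shift|exact: IH].
Qed.

End topology.

(** * Borel measures from weights on words *)

Section borel.
Context (R : realType) (k : nat).
Local Notation A := 'I_k.+1.
Local Notation X := (fullshift R k).

Definition cylinders : set (set X) :=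
  [set C | C = set0 \/ exists x n, C = cylinder x n].

Lemma cylinder_measurable (x : X) n : measurable (cylinder x n).
Proof. by apply: sub_sigma_algebra; exact: open_cylinder. Qed.

(** Words form a countable type, so indexing the union by them, with [set0] for the words whose
    cylinder leaves [U], makes every open set a countable union of cylinders. *)
Lemma open_bigcup_cylinder (U : set X) : open U ->
  U = \bigcup_w (if pselect (cylinder (hat R w) (size w) `<=` U)
                 then cylinder (hat R w) (size w) else set0).
Proof.
move=> oU; apply/seteqP; split => [x Ux|x [w _]]; last first.
  by case: pselect => // wU /wU.
have /nbhs_cylinderP[n nU] : nbhs x U by exact: open_nbhs_nbhs.
have xw : cylinder (hat R (mkseq x n)) (size (mkseq x n)) x.
  by move=> j; rewrite size_mkseq => jn; rewrite /hat nth_mkseq.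
exists (mkseq x n) => //; case: pselect => // -[] y yw; apply: nU => j jn.
rewrite yw ?size_mkseq// xw// size_mkseq//.
Qed.

Lemma measurable_cylindersE : @measurable _ X = <<s cylinders >>.
Proof.
apply/seteqP; split; apply: smallest_sub; try exact: smallest_sigma_algebra.
  move=> U /open_bigcup_cylinder ->.
  apply: (@countable_bigcupT_measurable _ (g_sigma_algebraType cylinders)) => // w.
  case: pselect => [wU|wU]/=; last exact: measurable0.
  by apply: sub_sigma_algebra; right; exists (hat R w), (size w).
move=> _ [->|[x [n ->]]]; first exact: (@measurable0 _ X).
exact: cylinder_measurable.
Qed.

Lemma cylinders_setI : setI_closed cylinders.
Proof.
move=> B C [->|[x [n ->]]]; first by left; rewrite set0I.
move=> [->|[y [m ->]]]; first by left; rewrite setI0.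
wlog nm : x n y m / (n <= m)%N.
  by move=> H; case: (leqP n m) => [/H//|/ltnW/H]; rewrite setIC; apply.
have [xy|nxy] := pselect (cylinder x n y).
  right; exists y, m; apply/seteqP; split => [z []//|z yz]; split => //.
  exact: cylinder_sub xy _ yz.
left; apply/seteqP; split => // z [xz yz]; apply: nxy => j jn.
by rewrite -xz// yz// (leq_trans jn).
Qed.

(** Two cylinders are nested or disjoint, so [cylinders] is a pi-system; it generates the Borel
    sets, and the whole space is the cylinder of length 0. *)
Lemma eq_measure_cylinder (m1 m2 : {measure set X -> \bar R}) :
  m1 setT = 1%E -> (forall x n, m1 (cylinder x n) = m2 (cylinder x n)) ->
  forall B, measurable B -> m1 B = m2 B.
Proof.
move=> m1T m12 B mB; have cyl0 : cylinder (point : X) 0 = setT by apply/seteqP.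
apply: (measure_unique cylinders (fun=> setT)) => //.
- exact: measurable_cylindersE.
- exact: cylinders_setI.
- by move=> _; right; exists point, 0%N.
- by apply/seteqP; split => // x _; exists 0%N.
- by move=> _ [->|[x [n ->]]//]; rewrite !measure0.
- by rewrite m1T => _; rewrite ltry.
Qed.

Lemma measurable_fun_cylinder d (T : measurableType d) (f : T -> X) :
  (forall x n, measurable (f @^-1` cylinder x n)) -> measurable_fun setT f.
Proof.
move=> mf; apply: (measurability _ measurable_cylindersE) => _ [_ [->|[x [n ->]]] <-].
  by rewrite preimage_set0 setI0; exact: measurable0.
by rewrite setTI; exact: mf.
Qed.

Lemma measurable_shift : measurable_fun setT (@left_shift R k).
Proof.
apply: (measurability (@open X)) => // _ [U oU <-]; rewrite setTI.
apply: sub_sigma_algebra; apply: open_comp => // x _; exact: continuous_left_shift.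
Qed.

Lemma measurable_iter_shift j : measurable_fun setT (iter j (@left_shift R k)).
Proof.
elim: j => [|j IH]; first exact: measurable_id.
exact: (measurableT_comp measurable_shift IH).
Qed.

Lemma continuous_measurable (f : X -> R) : continuous f -> measurable_fun setT f.
Proof.
move=> cf; apply: (measurability _ (measurable_realfun.RGenOpens.measurableE R)).
move=> _ [_ [a [b ->]] <-]; rewrite setTI; apply: sub_sigma_algebra.
apply: open_comp; last exact: interval_open.
by move=> x _; exact: cf.
Qed.

End borel.

(** * Lebesgue measure on the unit interval as a probability *)

Section unit_interval.
Context (R : realType).

Fact measurable_unit_interval : measurable (`[0, 1[%classic : set (measurableTypeR R)).
Proof. exact: measurable_itv. Qed.

Definition unit_measure : set (measurableTypeR R) -> \bar R :=
  mrestr lebesgue_measure measurable_unit_interval.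

HB.instance Definition _ := Measure.on unit_measure.

Let unit_measureT : unit_measure setT = 1%E.
Proof.
rewrite /unit_measure/= /mrestr setTI lebesgue_measure_itv/= lte_fin ltr01.
by rewrite sube0.
Qed.

HB.instance Definition _ :=
  Measure_isProbability.Build _ _ _ unit_measure unit_measureT.

End unit_interval.

(** * Measures with prescribed values on cylinders *)

Section measure_of_weights.
Context (R : realType) (k : nat).
Local Notation A := 'I_k.+1.
Local Notation X := (fullshift R k).

(** Kolmogorov's consistency conditions: [p w] is to be the probability of the cylinder of [w]. *)
Record weights (p : seq A -> R) : Prop := Weights {
  weight1 : p [::] = 1;
  weight_ge0 : forall w, 0 <= p w;
  weight_sum : forall w, \sum_a p (rcons w a) = p w }.

Variables (p : seq A -> R) (hp : weights p).

(* The interval [lo w, lo w + p w[ of each word: the intervals of the one-letter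
   extensions of w subdivide that of w, in the order of their last letters. *)
Definition lo (w : seq A) : R :=
  \sum_(i < size w) \sum_(b < k.+1 | (b < nth ord0 w i)%N) p (rcons (take i w) b).

Definition in_itv_of (w : seq A) (t : R) : bool := lo w <= t < lo w + p w.

Lemma lo_rcons w a :
  lo (rcons w a) = lo w + \sum_(b < k.+1 | (b < a)%N) p (rcons w b).
Proof.
rewrite /lo size_rcons big_ord_recr/=; congr (_ + _).
  apply: eq_bigr => i _; rewrite nth_rcons ltn_ord.
  by rewrite -cats1 takel_cat// ltnW.
rewrite nth_rcons ltnn eqxx; apply: eq_bigr => b _.
by rewrite -[rcons w a]cats1 take_size_cat.
Qed.

Lemma in_itv_of_rcons w a t : in_itv_of (rcons w a) t -> in_itv_of w t.
Proof.
rewrite /in_itv_of lo_rcons => /andP[l u]; apply/andP; split.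
  by apply: le_trans l; rewrite lerDl sumr_ge0// => b _; exact: weight_ge0.
apply: lt_le_trans u _; rewrite -addrA lerD2l.
rewrite -(weight_sum hp w) [leRHS](bigID (fun b : A => (b < a)%N))/= lerD2l.
rewrite (bigD1 a) ?ltnn//= lerDl sumr_ge0// => b _; exact: weight_ge0.
Qed.

Lemma in_itv_of_inj w a b t :
  in_itv_of (rcons w a) t -> in_itv_of (rcons w b) t -> a = b.
Proof.
wlog ab : a b / (a <= b)%N.
  by move=> H ta tb; case: (leqP a b) => [/H|/ltnW/H /(_ tb ta)]; [apply|move->].
move: ab; rewrite leq_eqVlt => /orP[/eqP ab _ _|ab]; first exact: val_inj.
rewrite /in_itv_of !lo_rcons => /andP[_ ta] /andP[tb _].
have := le_lt_trans tb ta; rewrite -addrA ltrD2l ltNge => /negP; case.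
rewrite [leRHS](bigID (fun c : A => (c < a)%N))/=.
have -> : \sum_(c < k.+1 | (c < b)%N && (c < a)%N) p (rcons w c) =
    \sum_(c < k.+1 | (c < a)%N) p (rcons w c).
  by apply: eq_bigl => c; case: (ltnP c a) => [ca|]; rewrite ?andbF// (ltn_trans ca ab).
by rewrite lerD2l (bigD1 a)/= ?ltnn ?ab// lerDl sumr_ge0// => c _; exact: weight_ge0.
Qed.

Lemma in_itv_of_ex w t : in_itv_of w t -> exists a, in_itv_of (rcons w a) t.
Proof.
move=> /andP[l u].
have ex : exists n, (n < k.+1)%N && (t < lo w + \sum_(b < k.+1 | (b <= n)%N) p (rcons w b)).
  exists k; rewrite ltnSn/= (eq_bigl predT) ?weight_sum// => b.
  by rewrite -ltnS ltn_ord.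
case: (ex_minnP ex) => n /andP[nk tn] nmin; exists (Ordinal nk).
rewrite /in_itv_of lo_rcons/= -addrA; apply/andP; split.
  case: n nk tn nmin => [|n] nk tn nmin; first by rewrite big_pred0_eq addr0.
  rewrite leNgt; apply/negP => tn'.
  have /nmin : (n < k.+1)%N && (t < lo w + \sum_(b < k.+1 | (b <= n)%N) p (rcons w b)).
    by rewrite (ltn_trans _ nk)//.
  by rewrite ltnn.
apply: (lt_le_trans tn); rewrite lerD2l (bigD1 (Ordinal nk))//= addrC lerD2r.
rewrite le_eqVlt; apply/orP; left; apply/eqP; apply: eq_bigl => b.
by rewrite -val_eqE/= ltn_neqAle andbC.
Qed.

Definition digit (t : R) (w : seq A) : A :=
  odflt ord0 [pick a | in_itv_of (rcons w a) t].

Definition itinerary (t : measurableTypeR R) : X := stream R (digit t).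

Lemma in_itv_of_nil t : in_itv_of [::] t = (0 <= t < 1).
Proof. by rewrite /in_itv_of /lo/= big_ord0 add0r weight1. Qed.

Lemma in_itv_of_walk t n : 0 <= t < 1 -> in_itv_of (walk (digit t) n) t.
Proof.
move=> t01; elim: n => [|n IH]/=; first by rewrite in_itv_of_nil.
rewrite {2}/digit; case: pickP => //= H.
by have [a] := in_itv_of_ex IH; rewrite H.
Qed.

Lemma walk_in_itv_of t w : 0 <= t < 1 ->
  (walk (digit t) (size w) == w) = in_itv_of w t.
Proof.
move=> t01; apply/eqP/idP => [<-|]; first exact: in_itv_of_walk.
elim/last_ind: w => [//|w a IH] wa; rewrite size_rcons/=.
rewrite (IH (in_itv_of_rcons wa)); congr rcons.
rewrite /digit; case: pickP => /= [b wb|/(_ a)]; last by rewrite wa.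
exact: in_itv_of_inj wb wa.
Qed.

(** Every interval lies in that of the empty word, [[0, 1[]; for [t] outside it each [pick] fails
    and the default [ord0] is returned. *)
Lemma itinerary_outside t : ~~ (0 <= t < 1) -> itinerary t = (fun=> ord0).
Proof.
move=> t01; apply/funext => n; rewrite /itinerary /stream /digit.
case: pickP => //= a H; exfalso; move/negP: t01; apply.
move: (rcons _ a) H => w; elim/last_ind: w => [|w b IH]; first by rewrite in_itv_of_nil.
by move=> /in_itv_of_rcons/IH.
Qed.

Lemma preimage_itinerary x n : itinerary @^-1` cylinder x n =
  [set` `[lo (mkseq x n), lo (mkseq x n) + p (mkseq x n)[] `|`
  (~` `[0, 1[ `&` [set _ | cylinder x n (fun=> ord0)]).
Proof.
have sub t : in_itv_of (mkseq x n) t -> 0 <= t < 1.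
  rewrite -in_itv_of_nil; move: (mkseq x n) => w.
  by elim/last_ind: w => [//|w b IH] /in_itv_of_rcons/IH.
apply/seteqP; split => t /=.
  case: (boolP (0 <= t < 1)) => t01.
    rewrite mkseq_cylinder -walkE -{1}(size_mkseq x n) => /eqP.
    by rewrite walk_in_itv_of// => H; left; rewrite in_itv.
  rewrite itinerary_outside// => H; right; split => //.
  by rewrite in_itv/=; exact/negP.
rewrite !in_itv/= => -[H|[/negP/itinerary_outside -> //]].
rewrite mkseq_cylinder -walkE -{1}(size_mkseq x n); apply/eqP.
by rewrite walk_in_itv_of//; exact: sub.
Qed.

Lemma measurable_itinerary : @measurable_fun _ _ (measurableTypeR R) X setT itinerary.
Proof.
apply: measurable_fun_cylinder => x n; rewrite preimage_itinerary.
apply: measurableU => //; apply: measurableI; first exact: measurableC.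
have [H|H] := pselect (cylinder x n (fun=> ord0)).
  by rewrite (_ : mkset _ = setT)//; apply/seteqP; split.
by rewrite (_ : mkset _ = set0)//; apply/seteqP; split.
Qed.


(** For [t] uniform in [[0, 1[], the itinerary begins with [w] exactly when [t] falls into the
    interval of [w], of length [p w]. The image of Lebesgue measure therefore has the prescribed
    cylinder weights. *)
Definition weight_measure : probability X R :=
  distribution (@unit_measure R) (mfun_Sub (mem_set measurable_itinerary)).

Lemma weight_measure_cylinder x n :
  weight_measure (cylinder x n) = (p (mkseq x n))%:E.
Proof.
rewrite /weight_measure/= /distribution/= /pushforward/= /unit_measure /mrestr.
rewrite preimage_itinerary setIUl [X in _ `|` X](_ : _ = set0) ?setU0; last first.
  by apply/seteqP; split => t //= [[]].
rewrite setIidl; last first.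
  move=> t /=; rewrite !in_itv/= => H; rewrite -in_itv_of_nil.
  have : in_itv_of (mkseq x n) t by [].
  move: (mkseq x n) => w.
  by elim/last_ind: w => [//|w b IH] /in_itv_of_rcons/IH.
rewrite lebesgue_measure_itv/= lte_fin ltrDl -EFinD addrC addKr.
by have := weight_ge0 hp (mkseq x n); rewrite le_eqVlt => /orP[/eqP <-|->//]; rewrite ltxx.
Qed.

End measure_of_weights.

(** * Shift-invariance in terms of weights *)

Section invariant_weights.
Context (R : realType) (k : nat).
Local Notation A := 'I_k.+1.
Local Notation X := (fullshift R k).

Definition xcons (a : A) (x : X) : X := fun n => if n is m.+1 then x m else a.

Lemma left_shift_xcons a x : left_shift (xcons a x) = x.
Proof. by []. Qed.

Lemma mkseq_xcons a x n : mkseq (xcons a x) n.+1 = a :: mkseq x n.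
Proof. by rewrite /mkseq/= -[1%N]addn0 iotaDl -map_comp. Qed.

Lemma preimage_shift_cylinder x n : @left_shift R k @^-1` cylinder x n =
  \big[setU/set0]_(a < k.+1) cylinder (xcons a x) n.+1.
Proof.
apply/seteqP; split => y.
  move=> xy; rewrite -bigcup_seq; exists (y 0%N); first by rewrite /= mem_index_enum.
  by move=> [//|j] jn; exact: xy.
by rewrite -bigcup_seq => -[a _ ay] j jn; exact: (ay j.+1).
Qed.

Lemma measure_preimage_shift (mu : probability X R) x n :
  mu (@left_shift R k @^-1` cylinder x n) =
  (\sum_(a < k.+1) mu (cylinder (xcons a x) n.+1))%E.
Proof.
rewrite preimage_shift_cylinder measure_semi_additive_ord//; last first.
  by apply: bigsetU_measurable => a _; exact: cylinder_measurable.
apply/trivIsetP => a b _ _ ab; apply/seteqP; split => // y [/(_ 0%N erefl) ya].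
  by move=> /(_ 0%N erefl) yb; move: ab; rewrite -[a]ya -[b]yb eqxx.
by move=> a; exact: cylinder_measurable.
Qed.

Lemma shift_invariant_weights (mu : probability X R) (p : seq A -> R) :
  (forall x n, mu (cylinder x n) = (p (mkseq x n))%:E) ->
  (forall w, \sum_a p (a :: w) = p w) -> shift_invariant mu.
Proof.
move=> mup pT; pose s : {mfun X >-> X} := mfun_Sub (mem_set (@measurable_shift R k)).
apply: (eq_measure_cylinder (m1 := distribution mu s)); first exact: probability_setT.
move=> x n; transitivity (mu (@left_shift R k @^-1` cylinder x n)); first by [].
transitivity (p (mkseq x n))%:E; last exact: esym (mup x n).
rewrite measure_preimage_shift -pT -sumEFin.
by apply: eq_bigr => a _; rewrite mup mkseq_xcons.
Qed.

End invariant_weights.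

(** * Integrals and entropy *)

Section bounded_measurable.
Context d (T : measurableType d) (R : realType).
Implicit Types f g : T -> R.

(** Such functions are integrable for every probability and stable under the operations below, so
    expectations can be computed as real numbers. *)
Definition bounded_measurable f : Prop :=
  measurable_fun setT f /\ exists M, forall x, `|f x| <= M.

Lemma bounded_measurable_integrable (mu : probability T R) f :
  bounded_measurable f -> mu.-integrable setT (EFin \o f).
Proof.
move=> [mf [M fM]]; apply: measurable_bounded_integrable => //.
  by rewrite (le_lt_trans (probability_le1 _ _))// ltry.
by exists M; split; [exact: num_real|move=> N MN x _; exact: le_trans (fM x) (ltW MN)].
Qed.

Lemma bounded_measurable_cst c : bounded_measurable (fun=> c).
Proof. by split; [exact: measurable_cst|exists `|c|]. Qed.

Lemma bounded_measurableD f g : bounded_measurable f -> bounded_measurable g ->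
  bounded_measurable (fun x => f x + g x).
Proof.
move=> [mf [M fM]] [mg [N gN]]; split; first exact: measurable_funD.
by exists (M + N) => x; rewrite (le_trans (ler_normD _ _))// lerD.
Qed.

Lemma bounded_measurableZ c f : bounded_measurable f ->
  bounded_measurable (fun x => c * f x).
Proof.
move=> [mf [M fM]]; split; first exact: measurable_funM (measurable_cst _) mf.
by exists (`|c| * M) => x; rewrite normrM ler_wpM2l.
Qed.

Lemma bounded_measurableB f g : bounded_measurable f -> bounded_measurable g ->
  bounded_measurable (fun x => f x - g x).
Proof.
move=> bf bg.
have := bounded_measurableD bf (bounded_measurableZ (-1) bg).
by congr bounded_measurable; apply/funext => x; rewrite mulN1r.
Qed.

Lemma bounded_measurable_sum (I : Type) (s : seq I) (F : I -> T -> R) :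
  (forall i, bounded_measurable (F i)) ->
  bounded_measurable (fun x => \sum_(i <- s) F i x).
Proof.
move=> bF; elim: s => [|i s IH].
  rewrite (_ : (fun _ => _) = fun=> 0); first exact: bounded_measurable_cst.
  by apply/funext => x; rewrite big_nil.
rewrite (_ : (fun _ => _) = fun x => F i x + \sum_(j <- s) F j x).
  exact: bounded_measurableD.
by apply/funext => x; rewrite big_cons.
Qed.

Lemma bounded_measurable_indic (B : set T) : measurable B ->
  bounded_measurable (\1_B : T -> R).
Proof.
move=> mB; split; first exact: measurable_indic.
by exists 1 => x; rewrite indicE; case: (x \in B); rewrite ?normr1 ?normr0.
Qed.

Variable mu : probability T R.

Lemma expect_cst c : \int[mu]_(x in setT) c = c.
Proof.
by rewrite Rintegral_cst// [X in fine X]probability_setT mulr1.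
Qed.

Lemma expectD f g : bounded_measurable f -> bounded_measurable g ->
  \int[mu]_(x in setT) (f x + g x) =
  \int[mu]_(x in setT) f x + \int[mu]_(x in setT) g x.
Proof. by move=> bf bg; rewrite RintegralD//; exact: bounded_measurable_integrable. Qed.

Lemma expectZ c f : bounded_measurable f ->
  \int[mu]_(x in setT) (c * f x) = c * \int[mu]_(x in setT) f x.
Proof. by move=> bf; rewrite RintegralZl//; exact: bounded_measurable_integrable. Qed.

Lemma expectB f g : bounded_measurable f -> bounded_measurable g ->
  \int[mu]_(x in setT) (f x - g x) =
  \int[mu]_(x in setT) f x - \int[mu]_(x in setT) g x.
Proof. by move=> bf bg; rewrite RintegralB//; exact: bounded_measurable_integrable. Qed.

Lemma expect_sum (I : Type) (s : seq I) (F : I -> T -> R) :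
  (forall i, bounded_measurable (F i)) ->
  \int[mu]_(x in setT) (\sum_(i <- s) F i x) =
  \sum_(i <- s) \int[mu]_(x in setT) F i x.
Proof.
move=> bF; elim: s => [|i s IH].
  by rewrite big_nil -[RHS]expect_cst; apply: eq_Rintegral => x _; rewrite big_nil.
rewrite big_cons -IH -expectD//; last exact: bounded_measurable_sum.
by apply: eq_Rintegral => x _; rewrite big_cons.
Qed.

Lemma le_expect f g : bounded_measurable f -> bounded_measurable g ->
  (forall x, f x <= g x) ->
  \int[mu]_(x in setT) f x <= \int[mu]_(x in setT) g x.
Proof.
by move=> bf bg fg; apply: le_Rintegral => //; exact: bounded_measurable_integrable.
Qed.

Lemma expect_indic (B : set T) : measurable B ->
  \int[mu]_(x in setT) (\1_B x : R) = fine (mu B).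
Proof. by move=> mB; rewrite /Rintegral integral_indic// setIT. Qed.

Lemma integral_expect f : bounded_measurable f ->
  (\int[mu]_x (f x)%:E)%E = (\int[mu]_(x in setT) f x)%:E.
Proof.
move=> bf; rewrite /Rintegral fineK//; apply: integrable_fin_num => //.
exact: bounded_measurable_integrable.
Qed.

Lemma fin_range_sum (F : finType) (h : T -> F) (g : F -> R) :
  g \o h = (fun x => \sum_w g w * \1_(h @^-1` [set w]) x).
Proof.
apply/funext => x /=; rewrite (bigD1 (h x))//= indicE mem_set// mulr1.
rewrite big1 ?addr0// => w wx; rewrite indicE memNset ?mulr0//= => hx.
by rewrite -hx eqxx in wx.
Qed.

Lemma bounded_measurable_fin_range (F : finType) (h : T -> F) (g : F -> R) :
  (forall w, measurable (h @^-1` [set w])) -> bounded_measurable (g \o h).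
Proof.
move=> mh; rewrite fin_range_sum; apply: bounded_measurable_sum => w.
by apply: bounded_measurableZ; exact: bounded_measurable_indic.
Qed.

Lemma expect_fin_range (F : finType) (h : T -> F) (g : F -> R) :
  (forall w, measurable (h @^-1` [set w])) ->
  \int[mu]_(x in setT) g (h x) = \sum_w fine (mu (h @^-1` [set w])) * g w.
Proof.
move=> mh; transitivity (\int[mu]_(x in setT) (\sum_w g w * \1_(h @^-1` [set w]) x)).
  by apply: eq_Rintegral => x _; rewrite -[LHS]/((g \o h) x) fin_range_sum.
have bi w : bounded_measurable (\1_(h @^-1` [set w]) : T -> R).
  exact: bounded_measurable_indic.
rewrite expect_sum => [|w]; last exact: bounded_measurableZ.
by apply: eq_bigr => w _; rewrite expectZ// expect_indic// mulrC.
Qed.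

End bounded_measurable.

(** * Gibbs' inequality and subadditive sequences *)

Section entropy_inequality.
Context (R : realType).

Lemma ler_ln_sub1 (x : R) : 0 < x -> ln x <= x - 1.
Proof.
by move=> x0; rewrite -{1}(subrK 1 x) addrC le_ln1Dx// ltrBrDr addNr.
Qed.

(** Apply [ln x <= x - 1] to [x = q w / r w] and sum against [r]: what remains is the difference of
    the total masses. Terms with [r w = 0] vanish on both sides. *)
Lemma gibbs_inequality (F : finType) (r q : F -> R) :
  (forall w, 0 <= r w) -> (forall w, 0 <= q w) ->
  (forall w, 0 < r w -> 0 < q w) -> \sum_w q w <= \sum_w r w ->
  - \sum_w r w * ln (r w) <= - \sum_w r w * ln (q w).
Proof.
move=> r0 q0 rq qr; rewrite -!sumrN -subr_le0 -sumrB.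
apply: (@le_trans _ _ (\sum_w (q w - r w))); last by rewrite sumrB subr_le0.
apply: ler_sum => w _; have := r0 w; rewrite le_eqVlt => /orP[/eqP <-|rw0].
  by rewrite !mul0r subrr subr0.
have qw0 := rq _ rw0; rewrite opprK addrC -mulrBr -ln_div//.
apply: (@le_trans _ _ (r w * (q w / r w - 1))).
  by rewrite ler_pM2l// ler_ln_sub1// divr_gt0.
by rewrite mulrBr mulr1 mulrCA divff ?mulr1// gt_eqF.
Qed.

(* Fekete's lemma *)
Lemma subadditive_cvg (a : nat -> R) : (forall n, 0 <= a n) ->
  (forall m n, a (m + n)%N <= a m + a n) -> cvgn (fun n => n%:R^-1 * a n).
Proof.
move=> a0 sub; pose E := [set n%:R^-1 * a n | n in [set n | (0 < n)%N]].
have lbE : lbound E 0 by move=> _ [n _ <-]; rewrite mulr_ge0// invr_ge0.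
have infE : has_inf E by split; [exists (1%:R^-1 * a 1%N), 1%N|exists 0].
have amul q n : a (q * n)%N <= q%:R * a n + a 0.
  elim: q => [|q IH]; first by rewrite mul0n mul0r add0r.
  by rewrite mulSn (le_trans (sub _ _))// -natr1 mulrDl mul1r addrAC [leRHS]addrC lerD2l.
apply/cvg_ex; exists (inf E); apply/cvgrPdist_le => e e0.
have e20 : 0 < e / 2 by rewrite divr_gt0.
have [_ [m /= m0 <-] mE] := inf_adherent e20 infE.
(* Dividing [n] by [m], the remainder costs at most one of the [a r], and [amul] costs [a 0]; [C]
   covers both and becomes negligible after division by [n]. *)
pose C := \sum_(r < m) a r + a 0.
have [N NC] : exists N, 2 * C / e < N%:R.
  have C0 : 0 <= C by rewrite /C addr_ge0// sumr_ge0.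
  by exists (Num.bound (2 * C / e)); rewrite archi_boundP// divr_ge0 ?mulr_ge0// ltW.
exists N.+1 => // n /= Nn; have n0 : (0 < n)%N by exact: leq_trans Nn.
have nR : 0 < n%:R :> R by rewrite ltr0n.
have mR : 0 < m%:R :> R by rewrite ltr0n.
have lo : inf E <= n%:R^-1 * a n by apply: ge_inf; [exists 0|exists n].
rewrite distrC ger0_norm ?subr_ge0// lerBlDl.
have an : a n <= n%:R * (m%:R^-1 * a m) + C.
  rewrite {1}(divn_eq n m) (le_trans (sub _ _))// (le_trans (lerD (amul _ _) (lexx _)))//.
  rewrite -addrA lerD//.
    rewrite mulrA ler_wpM2r// ler_pdivlMr// -natrM ler_nat leq_divM//.
  rewrite /C addrC lerD2r (bigD1 (Ordinal (ltn_pmod n m0)))//= lerDl sumr_ge0//.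
rewrite -(ler_pM2l nR) mulrA divff ?gt_eqF// mul1r (le_trans an)//.
have Ce : C <= n%:R * (e / 2).
  have {}NC : 2 * C / e < n%:R by rewrite (lt_trans NC)// ltr_nat.
  by move: NC; rewrite ltr_pdivrMr// => /ltW; rewrite mulrA ler_pdivlMr// mulrC.
have -> : inf E + e = (inf E + e / 2) + e / 2 by rewrite -addrA -splitr.
by rewrite mulrDr lerD// ler_wpM2l// ltW.
Qed.

End entropy_inequality.

(** * Names of points with respect to a partition *)

Section names.
Context (R : realType) (k : nat) (m : nat).
Local Notation A := 'I_k.+1.
Local Notation X := (fullshift R k).
Variables (P : 'I_m -> set X) (hP : measurable_partition P).

Lemma exists_atom x : exists i, P i x.
Proof.
by case: hP => _ _ PT; have : [set: X] x by []; rewrite -PT => -[i _ Pix]; exists i.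
Qed.

Definition atom_index x : 'I_m := sval (cid (exists_atom x)).

Lemma atom_indexP x i : P i x <-> atom_index x = i.
Proof.
have Px : P (atom_index x) x by exact: svalP (cid (exists_atom x)).
split=> [Pix|<-//]; case: hP => _ tP _.
by apply: (tP _ _ I I); exists x.
Qed.

Definition name n (x : X) : {ffun 'I_n -> 'I_m} :=
  [ffun j : 'I_n => atom_index (iter j (@left_shift R k) x)].

Lemma preimage_name n w : name n @^-1` [set w] = join_atom P w.
Proof.
apply/seteqP; split => x /=; first by move=> <- j _ /=; rewrite ffunE atom_indexP.
by move=> Px; apply/ffunP => j; rewrite ffunE -atom_indexP; exact: Px.
Qed.

Lemma measurable_join_atom n (w : {ffun 'I_n -> 'I_m}) : measurable (join_atom P w).
Proof.
apply: fin_bigcap_measurable; first exact: finite_finset.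
move=> j _; rewrite -[X in measurable X]setTI.
by apply: measurable_iter_shift => //; case: hP => mP _ _; exact: mP.
Qed.

Lemma measurable_preimage_name n w : measurable (name n @^-1` [set w]).
Proof. by rewrite preimage_name; exact: measurable_join_atom. Qed.

Variable mu : probability X R.

Lemma expect_name n (g : {ffun 'I_n -> 'I_m} -> R) :
  \sum_w fine (mu (join_atom P w)) * g w = \int[mu]_(x in setT) g (name n x).
Proof.
rewrite expect_fin_range; last exact: measurable_preimage_name.
by apply: eq_bigr => w _; rewrite preimage_name.
Qed.

Lemma sum_join_atom n :
  \sum_(w : {ffun 'I_n -> 'I_m}) fine (mu (join_atom P w)) = 1.
Proof.
rewrite -[RHS](expect_cst mu) -(expect_name (fun _ : {ffun 'I_n -> 'I_m} => 1)).
by apply: eq_bigr => w _; rewrite mulr1.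
Qed.

Lemma bounded_measurable_name n (g : {ffun 'I_n -> 'I_m} -> R) :
  bounded_measurable (fun x => g (name n x)).
Proof.
by apply: (bounded_measurable_fin_range (h := name n)) => w;
  exact: measurable_preimage_name.
Qed.

Lemma join_entropy_ge0 n : 0 <= join_entropy mu P n.
Proof.
rewrite /join_entropy oppr_ge0 sumr_le0// => w _.
rewrite mulr_ge0_le0 ?fine_ge0// ln_le0// -lee_fin fineK.
  by apply: probability_le1; exact: measurable_join_atom.
by apply: fin_num_measure; exact: measurable_join_atom.
Qed.

(** Gibbs' inequality for the law of the name under [mu] against a subprobability [q] on names, with
    the cross entropy written as an integral over points. *)
Lemma join_entropy_le_cross n (q : {ffun 'I_n -> 'I_m} -> R) :
  (forall w, 0 <= q w) -> (forall x, 0 < q (name n x)) -> \sum_w q w <= 1 ->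
  join_entropy mu P n <= - \int[mu]_(x in setT) ln (q (name n x)).
Proof.
move=> q0 qx qs; rewrite -(expect_name (fun w => ln (q w))).
apply: gibbs_inequality => //; first by move=> w; rewrite fine_ge0.
  (* [q] is known to be positive only on names of points; an atom of positive measure is non-empty,
     so its word is such a name. *)
  move=> w rw; have [x /= <-//] : (name n @^-1` [set w]) !=set0.
  apply/set0P/eqP => w0; move: rw; rewrite -preimage_name w0 measure0.
  by rewrite ltxx.
by rewrite sum_join_atom.
Qed.

End names.

(** * Expectations and the shift *)

Section invariance.
Context (R : realType) (k : nat).
Local Notation X := (fullshift R k).
Variables (mu : probability X R) (inv : shift_invariant mu).

Lemma bounded_measurable_iter_shift j (f : X -> R) : bounded_measurable f ->
  bounded_measurable (fun x => f (iter j (@left_shift R k) x)).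
Proof.
move=> [mf [M fM]]; split; last by exists M.
exact: (measurableT_comp mf (measurable_iter_shift j)).
Qed.

Lemma bounded_measurable_birkhoff n (f : X -> R) : bounded_measurable f ->
  bounded_measurable (birkhoff f n).
Proof.
move=> bf; apply: (@bounded_measurable_sum _ _ _ _ _ (fun (j : 'I_n) x => f (iter j _ x))) => j.
exact: bounded_measurable_iter_shift.
Qed.

Lemma continuous_bounded_measurable (f : X -> R) : continuous f -> bounded_measurable f.
Proof.
move=> cf; split; first exact: continuous_measurable.
by have [M _ fM] := continuous_bounded cf; exists M.
Qed.

Lemma expect_shift (f : X -> R) : bounded_measurable f ->
  \int[mu]_(x in setT) f (left_shift x) = \int[mu]_(x in setT) f x.
Proof.
move=> bf; congr fine.
have bfs := bounded_measurable_integrable mu (bounded_measurable_iter_shift 1 bf).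
rewrite -[LHS](integral_pushforward (@measurable_shift R k) (D := setT) (f := EFin \o f))//.
  pose s : {mfun X >-> X} := mfun_Sub (mem_set (@measurable_shift R k)).
  apply: (@eq_measure_integral _ _ _ _ mu (distribution mu s)) => B mB _.
  exact: inv.
by case: bf => mf _; exact/measurable_EFinP.
Qed.

Lemma expect_iter_shift j (f : X -> R) : bounded_measurable f ->
  \int[mu]_(x in setT) f (iter j (@left_shift R k) x) = \int[mu]_(x in setT) f x.
Proof.
move=> bf; elim: j => // j IH; rewrite -[RHS]IH.
rewrite -(expect_shift (bounded_measurable_iter_shift j bf)).
by apply: eq_Rintegral => x _; rewrite iterSr.
Qed.

Lemma expect_birkhoff n (f : X -> R) : bounded_measurable f ->
  \int[mu]_(x in setT) birkhoff f n x = n%:R * \int[mu]_(x in setT) f x.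
Proof.
move=> bf; rewrite (@expect_sum _ _ _ mu _ _ (fun (j : 'I_n) x => f (iter j _ x))).
  rewrite (eq_bigr (fun=> \int[mu]_(x in setT) f x)).
    by rewrite sumr_const card_ord mulr_natl.
  by move=> j _; exact: expect_iter_shift.
by move=> j; exact: bounded_measurable_iter_shift.
Qed.

End invariance.

(** * Approximation of Borel sets by clopen sets *)

Section clopen_approximation.
Context (R : realType) (k : nat).
Local Notation X := (fullshift R k).
Variable mu : probability X R.

Definition depends_on L (D : set X) : Prop := forall x y, cylinder x L y -> D x -> D y.

Lemma depends_on_measurable L D : depends_on L D -> measurable D.
Proof.
move=> LD; apply: sub_sigma_algebra; rewrite openE => x Dx.
by apply/nbhs_cylinderP; exists L => y xy; exact: LD Dx.
Qed.

Lemma depends_on_leq L M D : (L <= M)%N -> depends_on L D -> depends_on M D.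
Proof. by move=> LM LD x y xy; apply: LD; move=> j jL; apply: xy; exact: leq_trans LM. Qed.

Definition approximable (B : set X) : Prop := measurable B /\
  forall e : R, 0 < e -> exists L D, depends_on L D /\
    (mu ((B `\` D) `|` (D `\` B)) <= e%:E)%E.

Lemma depends_on_approximable L D : depends_on L D -> approximable D.
Proof.
move=> LD; split; first exact: depends_on_measurable LD.
by move=> e e0; exists L, D; split=> //; rewrite !setDv setU0 measure0 lee_fin ltW.
Qed.

Lemma approximableC B : approximable B -> approximable (~` B).
Proof.
move=> [mB aB]; split; first exact: measurableC.
move=> e e0; have [L [D [LD De]]] := aB e e0; exists L, (~` D); split.
  move=> x y xy Dx Dy; apply: Dx; apply: LD Dy => j jL; exact/esym/xy.
by rewrite !setDE !setCK setUC setIC [X in _ `|` X]setIC -!setDE.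
Qed.

Lemma approximableU B C : approximable B -> approximable C -> approximable (B `|` C).
Proof.
move=> [mB aB] [mC aC]; split; first exact: measurableU.
move=> e e0; have e20 : 0 < e / 2 by rewrite divr_gt0.
have [L [D [LD De]]] := aB _ e20; have [M [E [ME Ee]]] := aC _ e20.
have mD := depends_on_measurable LD; have mE := depends_on_measurable ME.
exists (maxn L M), (D `|` E); split.
  move=> x y xy [Dx|Ex]; [left|right].
    by apply: depends_on_leq LD _ _ xy Dx; rewrite leq_maxl.
  by apply: depends_on_leq ME _ _ xy Ex; rewrite leq_maxr.
have mDD (U V : set X) : measurable U -> measurable V ->
    measurable ((U `\` V) `|` (V `\` U)).
  by move=> mU mV; apply: measurableU; exact: measurableD.
rewrite (splitr e) EFinD (le_trans _ (leeD De Ee))//.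
rewrite (le_trans _ (measureU2 _ _ _))//; [|exact: mDD..].
rewrite le_measure// ?inE//; [by apply: mDD; apply: measurableU|by apply: measurableU; apply: mDD|].
by move=> x; rewrite /setD /setU/=; tauto.
Qed.

(** By continuity from above, some [C n] misses at most [e / 2] of the union; a clopen set within
    [e / 2] of this [C n] then serves for the union. *)
Lemma approximable_bigcup (C : (set X)^nat) : (forall n, approximable (C n)) ->
  {homo C : m n / (m <= n)%N >-> m `<=` n} -> approximable (\bigcup_n C n).
Proof.
move=> aC ndC; have mC n : measurable (C n) by case: (aC n).
have mU : measurable (\bigcup_n C n) by exact: bigcup_measurable.
split=> // e e0; have e20 : 0 < e / 2 by rewrite divr_gt0.
pose F n := (\bigcup_n C n) `\` C n.
have mF n : measurable (F n) by exact: measurableD.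
have F0 : \bigcap_n F n = set0.
  apply/seteqP; split => // x Fx; have [[n _ Cnx] _] := Fx 0%N I.
  by have [_] := Fx n I.
have : mu \o F @ \oo --> mu (\bigcap_n F n).
  apply: nonincreasing_cvg_mu => //.
  - by rewrite (le_lt_trans (probability_le1 _ _))// ltry.
  - exact: bigcap_measurable.
  - by move=> i j ij; apply/subsetPset => x [Ux Cx]; split=> // /(ndC _ _ ij).
rewrite F0 measure0 => /fine_cvgP[_ /cvgrPdist_le/(_ _ e20)[n _ /(_ n (leqnn n))]].
rewrite /= sub0r normrN ger0_norm ?fine_ge0// => Fn.
have [_ /(_ _ e20)[L [D [LD De]]]] := aC n; exists L, D; split => //.
have mD := depends_on_measurable LD.
have {}Fn : (mu (F n) <= (e / 2)%:E)%E by rewrite -[leLHS]fineK ?lee_fin// fin_num_measure.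
rewrite (splitr e) EFinD (le_trans _ (leeD Fn De))//.
have mDD : measurable ((C n `\` D) `|` (D `\` C n)) by apply: measurableU; exact: measurableD.
rewrite (le_trans _ (measureU2 _ _ _))// le_measure// ?inE//.
- by apply: measurableU; exact: measurableD.
- exact: measurableU.
- move=> x [[Ux Dx]|[Dx Ux]]; last by right; right; split=> // Cx; apply: Ux; exists n.
  by have [Cx|Cx] := pselect (C n x); [right; left|left].
Qed.

(** The approximable sets form a sigma-algebra containing the open sets: a countable union is the
    increasing union of its finite parts, and an open set that of the clopen sets of points whose
    [n]-cylinder it contains. *)
Lemma measurable_approximable B : measurable B -> approximable B.
Proof.
move: B; apply: smallest_sub; first split.
- exact: (@depends_on_approximable 0).
- by move=> B aB; rewrite setTD; exact: approximableC.
- move=> B aB; rewrite -(bigcup_bigsetU_bigcup).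
  apply: approximable_bigcup.
    move=> n; elim: n => [|n IH]; first by rewrite big_ord1.
    by rewrite big_ord_recr; exact: approximableU.
  move=> i j ij; rewrite -!bigcup_mkord; apply: bigcup_sub => a /= ai x Bx.
  by exists a => //=; apply: leq_trans ai _.
- move=> U oU; pose C n := [set x | cylinder x n `<=` U].
  have -> : U = \bigcup_n C n.
    apply/seteqP; split=> [x Ux|x [n _]]; last by apply.
    have /nbhs_cylinderP[n nU] : nbhs x U by exact: open_nbhs_nbhs.
    by exists n.
  apply: approximable_bigcup => [n|i j ij x Cx].
    apply: (@depends_on_approximable n) => x y xy Cx z yz; apply: Cx.
    exact: cylinder_sub xy _ yz.
  by apply: subset_trans Cx; exact: cylinder_sub.
Qed.

End clopen_approximation.

(** * Guessing the atom of a point from finitely many coordinates *)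

Section partition_approximation.
Context (R : realType) (k m : nat).
Local Notation X := (fullshift R k).
Variables (P : 'I_m -> set X) (hP : measurable_partition P).
Variable mu : probability X R.

(** [g] picks an index whose clopen approximation contains [x]; it can be wrong only on the
    symmetric difference of some [P i] and its approximation, and these have total measure at most
    [e]. *)
Lemma approximate_atom_index (e : R) : 0 < e ->
  exists L (g : X -> 'I_m), (forall x y, cylinder x L y -> g x = g y) /\
    bounded_measurable (fun x => (g x != atom_index hP x)%:R : R) /\
    \int[mu]_(x in setT) ((g x != atom_index hP x)%:R : R) <= e.
Proof.
move=> e0; have mP i : measurable (P i) by case: hP.
have em0 : 0 < e / m.+1%:R by rewrite divr_gt0.
have /choice[LD LDP] i : exists LD : nat * set X, depends_on LD.1 LD.2 /\
    (mu ((P i `\` LD.2) `|` (LD.2 `\` P i)) <= (e / m.+1%:R)%:E)%E.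
  have [_ /(_ _ em0)[L [D H]]] := measurable_approximable mu (mP i).
  by exists (L, D).
pose D i := (LD i).2; pose L := \max_i (LD i).1.
have DL i x y : cylinder x L y -> D i x = D i y.
  have HD : depends_on L (D i).
    by apply: depends_on_leq (proj1 (LDP i)); rewrite /L leq_bigmax.
  move=> xy; apply/propext; split; apply: HD => // j jL; exact/esym/xy.
pose g x := odflt (atom_index hP point) [pick i | `[< D i x >]].
have gL x y : cylinder x L y -> g x = g y.
  move=> xy; rewrite /g; congr odflt; apply: eq_pick => i.
  by rewrite (DL i x y xy).
have mD i : measurable (D i) by exact: depends_on_measurable (proj1 (LDP i)).
have mg i : measurable (g @^-1` [set i]).
  apply: (@depends_on_measurable _ _ L) => x y xy /= <-; exact/esym/gL.
have bm : bounded_measurable (fun x => (g x != atom_index hP x)%:R : R).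
  pose h (x : X) := (g x, atom_index hP x).
  apply: (@bounded_measurable_fin_range _ X R _ h (fun ij => (ij.1 != ij.2)%:R)) => -[i j].
  rewrite (_ : _ @^-1` _ = g @^-1` [set i] `&` P j); first exact: measurableI.
  apply/seteqP; split => x; rewrite /h/=; first by move=> [-> <-]; rewrite atom_indexP.
  by move=> [-> /atom_indexP ->].
exists L, g; split => //; split => //.
pose S i := (P i `\` D i) `|` (D i `\` P i).
have mS i : measurable (S i) by apply: measurableU; exact: measurableD.
apply: (@le_trans _ _ (\int[mu]_(x in setT) \sum_i \1_(S i) x)).
  apply: le_expect => //.
    by apply: bounded_measurable_sum => i; exact: bounded_measurable_indic.
  move=> x; have [nS|/existsNP[i /contrapT Six]] := pselect (forall i, ~ S i x); last first.
    rewrite (bigD1 i)//= indicE mem_set// (@le_trans _ _ 1)//; first by case: eqP.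
    by rewrite lerDl sumr_ge0.
  suff -> : g x = atom_index hP x by rewrite eqxx/= sumr_ge0.
  have DP i : D i x <-> P i x.
    by split=> H; apply: contrapT => H'; apply: (nS i); [right|left].
  rewrite /g; case: pickP => [i /asboolP/DP/atom_indexP//|/(_ (atom_index hP x))/negP].
  by case; apply/asboolP/DP/atom_indexP.
rewrite expect_sum; last by move=> i; exact: bounded_measurable_indic.
apply: (@le_trans _ _ (\sum_(i < m) e / m.+1%:R)).
  apply: ler_sum => i _; rewrite expect_indic// -lee_fin fineK ?fin_num_measure//.
  by case: (LDP i).
rewrite sumr_const card_ord -mulrnAl -mulr_natl mulrAC ler_piMl//; first exact: ltW.
by rewrite ler_pdivrMr// mul1r ler_nat.
Qed.

End partition_approximation.

(** * Bounds on the free energy *)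

Section entropy_upper_bound.
Context (R : realType) (k : nat).
Local Notation A := 'I_k.+1.
Local Notation X := (fullshift R k).
Variables (psi : X -> R) (cpsi : continuous psi).
Variables (mu nu : probability X R) (inv : shift_invariant mu).
Variables (Q e c : R).
Hypothesis nu_lb : forall x n,
  expR (- (n%:R * Q) + birkhoff psi n x - (n%:R * e + c)) <= fine (nu (cylinder x n)).

Lemma sum_tuple_cylinder N :
  \sum_(u : N.-tuple A) fine (nu (cylinder (hat R u) N)) = 1.
Proof.
pose h (x : X) : N.-tuple A := [tuple of mkseq x N].
have hE u : h @^-1` [set u] = cylinder (hat R u) N.
  have hu : mkseq (hat R u) N = u by have := mkseq_hat R u; rewrite size_tuple.
  apply/seteqP; split => x /=; rewrite mkseq_cylinder hu; first by move=> <-.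
  by move=> xu; exact: val_inj.
rewrite -[RHS](expect_cst nu) (expect_fin_range nu (h := h) (fun=> 1)).
  by apply: eq_bigr => u _; rewrite hE mulr1.
by move=> u; rewrite hE; exact: cylinder_measurable.
Qed.

(** A law [q] on names is built from [nu], and Gibbs' inequality bounds the entropy by the
    expectation of [- ln q] at the name. The bound [nu_lb] gives the main term; the channel and the
    rare wrong guesses cost at most [d] per letter. *)
Lemma join_entropy_upper m (P : 'I_m -> set X) (hP : measurable_partition P) (d : R) :
  0 < d -> exists C, forall n, join_entropy mu P n <=
    n%:R * (Q + e - \int[mu]_(x in setT) psi x + d) + C.
Proof.
move=> d0; have m0 : (0 < m)%N.
  by rewrite (leq_ltn_trans (leq0n _) (ltn_ord (atom_index hP point))).
set I := \int[mu]_(x in setT) psi x.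
pose t := expR (- (d / 2)).
have t1 : t < 1 by rewrite /t expR_lt1 oppr_lt0 divr_gt0.
have t0 : 0 < t by exact: expR_gt0.
pose s := (1 - t) / m%:R; have s0 : 0 < s by rewrite divr_gt0 ?subr_gt0 ?ltr0n.
(* A noisy channel: the guess is kept with weight [t], and every letter receives [s] more, so that
   no name gets weight 0. *)
pose kap (a b : 'I_m) := (if a == b then t else 0) + s.
have kap0 a b : 0 < kap a b by rewrite /kap; case: eqP => _; rewrite ?add0r// addr_gt0.
have kap1 a : \sum_b kap a b = 1.
  rewrite /kap big_split/= -big_mkcond/= (big_pred1 a) => [|b]; last by rewrite /= eq_sym.
  rewrite sumr_const card_ord -mulr_natr.
  by rewrite /s divfK ?pnatr_eq0 -?lt0n// addrC subrK.
pose La : R := `|ln s|.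
have kap_lb a b : expR (- (d / 2) - La * (a != b)%:R) <= kap a b.
  rewrite /kap; case: eqP => _ /=; first by rewrite mulr0 subr0 lerDl ltW.
  rewrite mulr1 add0r -[leRHS](lnK s0) ler_expR (@le_trans _ _ (- La))//.
    by rewrite gerDr oppr_le0 divr_ge0// ltW.
  by rewrite lerNl /La -normrN ler_norm.
(* Chosen so that [La * et <= d / 2], where [La] is the logarithmic cost of a wrong guess; the [+ 1]
   keeps the denominator positive. *)
pose et := d / (2 * (La + 1)).
have La0 : 0 <= La by exact: normr_ge0.
have La1 : 0 < La + 1 by rewrite ltr_wpDl.
have et0 : 0 < et by rewrite divr_gt0// mulr_gt0.
have [L [g [gL [bmis mis]]]] := approximate_atom_index hP mu et0.
(* The guess at a time [j < n] reads [L] letters from position [j] on, hence cylinders of length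
   [n + L]; the [L] extra letters go into the constant. *)
exists (L%:R * (Q + e - I) + c) => n; set N := (n + L)%N.
pose p (u : N.-tuple A) := fine (nu (cylinder (hat R u) N)).
(* q is the law of a random name: draw a point from nu, guess the atoms of its
   first n iterates by g, and corrupt each guess independently by the channel kap. *)
pose q (w : {ffun 'I_n -> 'I_m}) := \sum_u p u *
  \prod_(j < n) kap (g (iter j (@left_shift R k) (hat R u))) (w j).
(* The logarithm of a lower bound for the one term of [q] that comes from the prefix of [x]
   itself. *)
pose Phi (x : X) := (- (N%:R * Q) + birkhoff psi N x - (N%:R * e + c)) +
  \sum_(j < n) (- (d / 2) - La * (g (iter j (@left_shift R k) x)
       != atom_index hP (iter j (@left_shift R k) x))%:R).
have p0 u : 0 <= p u by exact: fine_ge0.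
have qPhi x : expR (Phi x) <= q (name hP n x).
  have hx : mkseq (hat R (mkseq x N)) N = mkseq x N.
    by have := mkseq_hat R (mkseq x N); rewrite size_mkseq.
  have cx : cylinder x N (hat R (mkseq x N)) by apply/mkseq_cylinder.
  pose u : N.-tuple A := [tuple of mkseq x N].
  rewrite /q (bigD1 u)//= ler_wpDr//.
    by apply: sumr_ge0 => v _; rewrite mulr_ge0// prodr_ge0// => j _; exact: ltW.
  rewrite /Phi expRD ler_pM ?expR_ge0//.
    rewrite /p (_ : cylinder _ _ = cylinder x N)//.
    by apply/seteqP; split => y; rewrite !mkseq_cylinder hx.
  rewrite expR_sum; apply: ler_prod => j _; rewrite expR_ge0/= ffunE.
  rewrite (_ : g (iter j _ (hat R u)) = g (iter j (@left_shift R k) x)); first exact: kap_lb.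
  apply/esym/gL; apply: (cylinder_shift cx); rewrite /N leq_add2r ltnW//.
have bpsi : bounded_measurable psi by exact: continuous_bounded_measurable.
have bS : bounded_measurable (birkhoff psi N) by exact: bounded_measurable_birkhoff.
pose f (x : X) : R := - (d / 2) - La * (g x != atom_index hP x)%:R.
have bf : bounded_measurable f.
  apply: bounded_measurableB; first exact: bounded_measurable_cst.
  exact: bounded_measurableZ.
have PhiE x : Phi x = birkhoff psi N x + birkhoff f n x - (N%:R * Q + N%:R * e + c).
  by rewrite /Phi /birkhoff; ring.
have bPhi : bounded_measurable Phi.
  rewrite (funext PhiE); apply: bounded_measurableB; last exact: bounded_measurable_cst.
  by apply: bounded_measurableD => //; exact: bounded_measurable_birkhoff.
have EPhi : \int[mu]_(x in setT) Phi x =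
    N%:R * I + n%:R * \int[mu]_(x in setT) f x - (N%:R * Q + N%:R * e + c).
  have EB (h : X -> R) r : bounded_measurable h ->
      \int[mu]_(x in setT) (birkhoff psi N x + birkhoff h n x - r) =
      N%:R * I + n%:R * \int[mu]_(x in setT) h x - r.
    move=> bh; have bhn := bounded_measurable_birkhoff n bh.
    rewrite expectB ?expect_cst; [|exact: bounded_measurableD|exact: bounded_measurable_cst].
    by rewrite expectD// !expect_birkhoff.
  by rewrite -EB//; apply: eq_Rintegral => x _; rewrite PhiE.
have Ef : - d <= \int[mu]_(x in setT) f x.
  rewrite expectB ?expectZ ?expect_cst//; last 2 first.
  - exact: bounded_measurable_cst.
  - exact: bounded_measurableZ.
  have misd : La * \int[mu]_(x in setT) ((g x != atom_index hP x)%:R : R) <= d / 2.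
    rewrite (le_trans (ler_wpM2l _ mis)) ?normr_ge0//.
    rewrite (_ : La * et = d / 2 * (La / (La + 1))); last first.
      by rewrite /et; field; rewrite gt_eqF.
    by rewrite ler_piMr ?divr_ge0 ?ltW// ltr_pdivrMr// mul1r ltrDl.
  by rewrite [in leLHS](splitr d) opprD lerD2l lerN2.
apply: (@le_trans _ _ (- \int[mu]_(x in setT) Phi x)).
  apply: (@le_trans _ _ (- \int[mu]_(x in setT) ln (q (name hP n x)))).
    apply: join_entropy_le_cross => //.
    - move=> w; apply: sumr_ge0 => u _.
      by rewrite mulr_ge0// prodr_ge0// => j _; exact: ltW.
    - by move=> x; apply: lt_le_trans (qPhi x); exact: expR_gt0.
    rewrite /q exchange_big/= (eq_bigr p) ?sum_tuple_cylinder// => u _.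
    rewrite -mulr_sumr -(bigA_distr_bigA
      (fun (j : 'I_n) => kap (g (iter j (@left_shift R k) (hat R u)))))/=.
    by under eq_bigr do rewrite kap1; rewrite big1_eq mulr1.
  rewrite lerN2; apply: le_expect => //.
    exact: (bounded_measurable_name hP (fun w => ln (q w))).
  move=> x; rewrite -[leLHS]expRK ler_ln// ?posrE ?expR_gt0//.
  exact: lt_le_trans (expR_gt0 _) (qPhi x).
rewrite EPhi /N natrD.
have := ler_wpM2l (ler0n R n) Ef; set J := (\int[mu]_(x in setT) f x); lra.
Qed.

End entropy_upper_bound.

(** * Limits of averages *)

Section average_limits.
Context (R : realType).

Lemma near_divn_le (C e : R) : 0 < e -> \forall n \near \oo, n%:R^-1 * C <= e.
Proof.
move=> e0; exists (Num.bound (`|C| / e)).+1 => // n /= Nn.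
have n0 : 0 < n%:R :> R by rewrite ltr0n (leq_trans _ Nn).
rewrite ler_pdivrMl// (le_trans (ler_norm _))// -ler_pdivrMr// ltW//.
by rewrite (lt_trans (archi_boundP _)) ?ltr_nat// divr_ge0// ltW.
Qed.

(* For a divergent sequence [limn] is the junk value 0, hence the sign condition. *)
Lemma limn_average_le (a : nat -> R) B : (forall n, 0 <= a n) ->
  (forall d, 0 < d -> exists C, forall n, a n <= n%:R * (B + d) + C) ->
  limn (fun n => n%:R^-1 * a n) <= B.
Proof.
move=> a0 aB; apply/ler_addgt0Pl => e e0.
have e20 : 0 < e / 2 by rewrite divr_gt0.
have [C aC] := aB _ e20.
have up : \forall n \near \oo, n%:R^-1 * a n <= e + B.
  near=> n.
  have n0 : 0 < n%:R :> R by rewrite ltr0n; near: n; exists 1%N.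
  have Ce : n%:R^-1 * C <= e / 2 by near: n; exact: near_divn_le.
  apply: (@le_trans _ _ (n%:R^-1 * (n%:R * (B + e / 2) + C))).
    by rewrite ler_pM2l ?invr_gt0.
  rewrite mulrDr mulrA mulVf ?gt_eqF// mul1r [in leRHS](splitr e); lra.
have [ca|dva] := pselect (cvgn (fun n => n%:R^-1 * a n)); first exact: limr_le.
rewrite dvgP//; case: up => N _ /(_ N (leqnn _)); apply: le_trans.
by rewrite mulr_ge0// invr_ge0.
Unshelve. all: by end_near. Qed.

Lemma cvg_average_ge (a : nat -> R) B C : cvgn (fun n => n%:R^-1 * a n) ->
  (forall n, n%:R * B - C <= a n) -> B <= limn (fun n => n%:R^-1 * a n).
Proof.
move=> ca aB; apply/ler_addgt0Pl => e e0; rewrite -lerBlDl; apply: limr_ge => //.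
near=> n.
have n0 : 0 < n%:R :> R by rewrite ltr0n; near: n; exists 1%N.
have Ce : n%:R^-1 * C <= e by near: n; exact: near_divn_le.
apply: (@le_trans _ _ (n%:R^-1 * (n%:R * B - C))); last by rewrite ler_pM2l ?invr_gt0.
by rewrite mulrBr mulrA mulVf ?gt_eqF// mul1r lerD2l lerN2.
Unshelve. all: by end_near. Qed.

End average_limits.

(** * The free energy as entropy plus integral *)

Section free_energy_limit.
Context (R : realType) (k : nat).
Local Notation X := (fullshift R k).
Variables (psi : X -> R) (cpsi : continuous psi).
Variables (mu : probability X R) (inv : shift_invariant mu).

(** By invariance [birkhoff psi n] integrates to [n] times the integral of [psi], and [b n] bounds
    the error before division by [n]. The value does not depend on [F], which later transfers
    equilibrium measures. *)
Lemma free_energy_near (F : nat -> X -> R) (b : nat -> R) :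
  (forall n, (0 < n)%N -> bounded_measurable (F n)) ->
  (forall n x, (0 < n)%N -> `|F n x - birkhoff psi n x| <= b n) ->
  n%:R^-1 * b n @[n --> \oo] --> 0 ->
  free_energy F mu = (ks_entropy mu + (\int[mu]_(x in setT) psi x)%:E)%E.
Proof.
move=> bF Fb b0; congr (_ + _)%E; set I := \int[mu]_(x in setT) psi x.
have bpsi : bounded_measurable psi by exact: continuous_bounded_measurable.
apply/cvg_lim => //.
have cr : n%:R^-1 * \int[mu]_(x in setT) F n x @[n --> \oo] --> I.
  apply/cvgrPdist_le => e e0; near=> n.
  have n0 : (0 < n)%N by near: n; exists 1%N.
  have n0R : 0 < n%:R :> R by rewrite ltr0n.
  have bS := bounded_measurable_birkhoff n bpsi.
  have be : n%:R^-1 * b n <= e.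
    near: n; move/cvgrPdist_le: b0 => /(_ e e0); apply: filterS => n.
    by rewrite sub0r normrN; apply: le_trans; exact: ler_norm.
  apply: le_trans be; rewrite -[I](mulKf (lt0r_neq0 n0R)) -expect_birkhoff//.
  rewrite -mulrBr normrM ger0_norm ?invr_ge0// ler_pM2l ?invr_gt0// distrC.
  rewrite -expectB//; last exact: bF.
  rewrite ler_norml -[b n](expect_cst mu) -mulN1r -expectZ; last first.
    exact: bounded_measurable_cst.
  have bd := bounded_measurableB (bF n n0) bS.
  have bc := @bounded_measurable_cst _ X R (b n).
  apply/andP; split.
    apply: (le_expect mu (bounded_measurableZ (-1) bc) bd) => x.
    by have := Fb n x n0; rewrite ler_norml mulN1r => /andP[].
  apply: (le_expect mu bd bc) => x.
  by have := Fb n x n0; rewrite ler_norml => /andP[].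
have : (n%:R^-1 * \int[mu]_(x in setT) F n x)%:E @[n --> \oo] --> I%:E.
  by apply: cvg_EFin; [exact: nearW|exact: cr].
apply: cvg_trans; apply: near_eq_cvg; near=> n.
have n0 : (0 < n)%N by near: n; exists 1%N.
by rewrite integral_expect ?EFinM//; exact: bF.
Unshelve. all: by end_near. Qed.

Lemma free_energy_birkhoff : free_energy (birkhoff psi) mu =
  (ks_entropy mu + (\int[mu]_(x in setT) psi x)%:E)%E.
Proof.
apply: (@free_energy_near _ (fun=> 0)).
- by move=> n _; apply: bounded_measurable_birkhoff; exact: continuous_bounded_measurable.
- by move=> n x _; rewrite subrr normr0.
- rewrite (_ : (fun n => _) = fun=> 0); first exact: cvg_cst.
  by apply/funext => n; rewrite mulr0.
Qed.

End free_energy_limit.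

(** * Free energy from two-sided bounds on cylinders *)

Section pressure_bounds.
Context (R : realType) (k : nat).
Local Notation A := 'I_k.+1.
Local Notation X := (fullshift R k).
Variables (psi : X -> R) (cpsi : continuous psi).

Lemma free_energy_upper (mu nu : probability X R) (Q e c : R) :
  shift_invariant mu ->
  (forall x n, expR (- (n%:R * Q) + birkhoff psi n x - (n%:R * e + c)) <=
    fine (nu (cylinder x n))) ->
  (free_energy (birkhoff psi) mu <= (Q + e)%:E)%E.
Proof.
move=> inv nu_lb; rewrite free_energy_birkhoff// -leeBrDr// -EFinB.
apply: ub_ereal_sup => _ [m [P [hP ->]]]; rewrite lee_fin.
apply: limn_average_le; first exact: join_entropy_ge0.
by move=> d d0; have [C HC] := join_entropy_upper cpsi inv nu_lb hP d0; exists C.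
Qed.

Definition letter_partition (i : A) : set X := [set x | x 0%N = i].

Lemma letter_partitionP : measurable_partition letter_partition.
Proof.
split.
- move=> i; rewrite (_ : letter_partition i = cylinder (fun=> i) 1).
    exact: cylinder_measurable.
  by apply/seteqP; split=> [x xi [|//]//|x]; exact.
- by move=> i j _ _ [x [<- <-]].
- by apply/seteqP; split=> // x _; exists (x 0%N).
Qed.

Lemma join_atom_letter n (x : X) :
  join_atom letter_partition (name letter_partitionP n x) = cylinder x n.
Proof.
have ai y : atom_index letter_partitionP y = y 0%N by apply/atom_indexP.
apply/seteqP; split => y.
  move=> Py j jn; have := Py (Ordinal jn) I.
  by rewrite /= /letter_partition/= ffunE ai !iter_shift !addn0.
move=> xy j _; rewrite /= /letter_partition/= ffunE ai !iter_shift !addn0.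
exact: xy.
Qed.

Variables (mu : probability X R) (inv : shift_invariant mu).
Hypothesis mu_gt0 : forall x n, 0 < fine (mu (cylinder x n)).

Lemma letter_entropyE n : join_entropy mu letter_partition n =
  - \int[mu]_(x in setT) ln (fine (mu (cylinder x n))).
Proof.
rewrite /join_entropy (expect_name letter_partitionP mu
  (fun w => ln (fine (mu (join_atom letter_partition w))))).
by congr (- _); apply: eq_Rintegral => x _; rewrite join_atom_letter.
Qed.

Lemma bounded_measurable_cylinder n :
  bounded_measurable (fun x => ln (fine (mu (cylinder x n)))).
Proof.
have := bounded_measurable_name letter_partitionP
  (fun w : {ffun 'I_n -> A} => ln (fine (mu (join_atom letter_partition w)))).
by congr bounded_measurable; apply/funext => x; rewrite join_atom_letter.
Qed.

Lemma sum_split_ffun m n (G : {ffun 'I_m -> A} -> {ffun 'I_n -> A} -> R) :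
  \sum_(w : {ffun 'I_(m + n) -> A})
    G [ffun i => w (lshift n i)] [ffun i => w (rshift m i)] =
  \sum_u \sum_v G u v.
Proof.
rewrite pair_big/=.
pose f (uv : {ffun 'I_m -> A} * {ffun 'I_n -> A}) : {ffun 'I_(m + n) -> A} :=
  [ffun i => match fintype.split i with inl j => uv.1 j | inr j => uv.2 j end].
pose g (w : {ffun 'I_(m + n) -> A}) : {ffun 'I_m -> A} * {ffun 'I_n -> A} :=
  ([ffun i => w (lshift n i)], [ffun i => w (rshift m i)]).
have fK : cancel f g.
  move=> [u v]; congr pair; apply/ffunP => i; rewrite !ffunE.
    by rewrite (unsplitK (inl i)).
  by rewrite (unsplitK (inr i)).
have gK : cancel g f.
  move=> w; apply/ffunP => i; rewrite ffunE -{2}(splitK i).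
  by case: (fintype.split i) => j; rewrite ffunE.
rewrite (reindex f); last by exists g => x _.
by apply: eq_bigr => uv _; rewrite -[X in G X _]/(g (f uv)).1 -[X in G _ X]/(g (f uv)).2 fK.
Qed.

(** Gibbs' inequality against the product law, under which the first [m] and the next [n] letters
    are independent; invariance identifies the contribution of the latter with that of the first
    [n]. *)
Lemma letter_entropy_subadditive m n : join_entropy mu letter_partition (m + n) <=
  join_entropy mu letter_partition m + join_entropy mu letter_partition n.
Proof.
pose r l (u : {ffun 'I_l -> A}) := fine (mu (join_atom letter_partition u)).
have r0 l u : 0 <= @r l u by exact: fine_ge0.
pose q (w : {ffun 'I_(m + n) -> A}) :=
  r m [ffun i => w (lshift n i)] * r n [ffun i => w (rshift m i)].
have qE x : q (name letter_partitionP (m + n) x) =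
    fine (mu (cylinder x m)) * fine (mu (cylinder (iter m (@left_shift R k) x) n)).
  rewrite /q /r; congr (fine (mu _) * fine (mu _)); rewrite -join_atom_letter; congr join_atom.
    by apply/ffunP => i; rewrite !ffunE.
  by apply/ffunP => i; rewrite !ffunE/= addnC iterD.
have : join_entropy mu letter_partition (m + n) <=
    - \int[mu]_(x in setT) ln (q (name letter_partitionP (m + n) x)).
  apply: join_entropy_le_cross.
  - by move=> w; rewrite mulr_ge0.
  - by move=> x; rewrite qE mulr_gt0.
  - rewrite /q (sum_split_ffun (fun u v => r m u * r n v)).
    under eq_bigr do rewrite -mulr_sumr (sum_join_atom letter_partitionP) mulr1.
    by rewrite (sum_join_atom letter_partitionP).
move/le_trans; apply; rewrite !letter_entropyE -opprD lerN2.
have bm l := bounded_measurable_cylinder l.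
rewrite -[X in _ + X](expect_iter_shift inv m (bm n)) -expectD//; last first.
  exact: (bounded_measurable_iter_shift m (bm n)).
rewrite le_eqVlt; apply/orP; left; apply/eqP; apply: eq_Rintegral => x _.
by rewrite qE lnM ?posrE.
Qed.

(** One partition suffices from below: the atoms of the letter partition are cylinders, so [mu_ub]
    bounds its join entropies from below. Subadditivity makes their averages converge, so that
    [limn] is a true limit. *)
Lemma free_energy_lower (Q e c : R) :
  (forall x n, fine (mu (cylinder x n)) <=
    expR (- (n%:R * Q) + birkhoff psi n x + (n%:R * e + c))) ->
  ((Q - e)%:E <= free_energy (birkhoff psi) mu)%E.
Proof.
move=> mu_ub; rewrite free_energy_birkhoff// -leeBlDr// -EFinB.
apply: (@le_trans _ _ (partition_entropy mu letter_partition)%:E); last first.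
  by apply: ereal_sup_ubound; exists k.+1, letter_partition; split => //; exact: letter_partitionP.
rewrite lee_fin; set I := \int[mu]_(x in setT) psi x.
apply: (@cvg_average_ge _ _ _ c).
  apply: subadditive_cvg; first exact: (join_entropy_ge0 letter_partitionP).
  exact: letter_entropy_subadditive.
move=> n; rewrite letter_entropyE.
have bpsi : bounded_measurable psi by exact: continuous_bounded_measurable.
have bS := bounded_measurable_birkhoff n bpsi.
have bc r : bounded_measurable (fun _ : X => r) by exact: bounded_measurable_cst.
rewrite -lerN2 opprK.
apply: (@le_trans _ _ (\int[mu]_(x in setT) (birkhoff psi n x - (n%:R * Q - n%:R * e - c)))).
  apply: le_expect => [| |x]; first exact: bounded_measurable_cylinder.
    exact: bounded_measurableB.
  rewrite -ler_expR lnK ?posrE// (le_trans (mu_ub x n))// ler_expR; lra.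
rewrite expectB// expect_cst expect_birkhoff// -/I; lra.
Qed.

End pressure_bounds.

(** * Block measures and the pressure *)

Section birkhoff_oscillation.
Context (R : realType) (k : nat).
Local Notation A := 'I_k.+1.
Local Notation X := (fullshift R k).
Variables (psi : X -> R) (cpsi : continuous psi).

(** Uniform continuity at depth [N] controls all but about the last [N] iterates by [e] each; the
    remaining ones contribute at most [2 * M] each. *)
Lemma birkhoff_oscillation (e : R) : 0 < e -> exists2 C, 0 <= C &
  forall n x y, cylinder x n y ->
    `|birkhoff psi n x - birkhoff psi n y| <= n%:R * e + C.
Proof.
move=> e0; have [N HN] := uniformly_continuous_cylinder cpsi e0.
have [M M0 HM] := continuous_bounded cpsi.
exists (N%:R * (2 * M)); first by rewrite !mulr_ge0.
elim=> [|n IH] x y xy.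
  by rewrite /birkhoff !big_ord0 subrr normr0 mul0r add0r !mulr_ge0.
have [Nn|nN] := leqP N n.+1.
  have h1 := ltW (HN _ _ (fun j jN => xy j (leq_trans jN Nn))).
  have h2 := IH _ _ (@cylinder_shift _ _ _ _ n n.+1 1 xy (leqnn _)).
  rewrite !birkhoffS opprD addrACA -natr1.
  rewrite (le_trans (ler_normD _ _))// (le_trans (lerD h1 h2))//; lra.
rewrite ler_wpDl ?mulr_ge0 ?(ltW e0)// /birkhoff -sumrB (le_trans (ler_norm_sum _ _ _))//.
apply: (@le_trans _ _ (\sum_(j < n.+1) (2 * M))).
  by apply: ler_sum => j _; rewrite (le_trans (ler_normB _ _))// mulr2n mulrDl !mul1r lerD.
by rewrite sumr_const card_ord -[leLHS]mulr_natl ler_wpM2r ?mulr_ge0// ler_nat ltnW.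
Qed.

Lemma birkhoff_bound (M : R) (hM : forall x, `|psi x| <= M) n x :
  `|birkhoff psi n x| <= n%:R * M.
Proof.
rewrite (le_trans (ler_norm_sum _ _ _))//.
apply: (@le_trans _ _ (\sum_(j < n) M)); first by apply: ler_sum.
by rewrite sumr_const card_ord mulr_natl.
Qed.

End birkhoff_oscillation.

(** * Weights of independent blocks *)

Section block_weights.
Context (R : realType) (k : nat).
Local Notation A := 'I_k.+1.
Local Notation X := (fullshift R k).
Variables (psi : X -> R).

(* The sum of exp (S_n psi (v 0 0 ...)) over the words v of length n = r + |u|
   that extend u. *)
Fixpoint part_sum r (u : seq A) : R :=
  if r is r'.+1 then \sum_a part_sum r' (rcons u a)
  else expR (birkhoff psi (size u) (hat R u)).

Definition Zsum n := part_sum n [::].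

(* The letters are read in independent consecutive blocks, the first one u
   having r letters still to come, the next ones having lengths
   (l 0).+1, (l 1).+1, ...  A complete block b has probability
   exp (S psi (b 0 0 ...)) / Zsum |b|. *)
Fixpoint block_rec (l : nat -> nat) r (u w : seq A) : R :=
  match w, r with
  | [::], _ => part_sum r u / Zsum (r + size u)
  | a :: w', r'.+1 => block_rec l r' (rcons u a) w'
  | a :: w', 0%N => part_sum 0 u / Zsum (size u) *
      block_rec (fun i => l i.+1) (l 0%N) [:: a] w'
  end.

Definition block_weight l w := block_rec l 0 [::] w.

Lemma part_sum_gt0 r u : 0 < part_sum r u.
Proof.
elim: r u => [|r IH] u /=; first exact: expR_gt0.
by rewrite (bigD1 ord0)//= ltr_wpDr// sumr_ge0// => a _; exact: ltW.
Qed.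

Lemma Zsum_gt0 n : 0 < Zsum n. Proof. exact: part_sum_gt0. Qed.

Lemma expR_div_Zsum0 : expR (birkhoff psi 0 (hat R [::])) / Zsum 0 = 1.
Proof. by rewrite divff// gt_eqF// expR_gt0. Qed.

Lemma block_rec_gt0 l r u w : 0 < block_rec l r u w.
Proof.
elim: w l r u => [|a w IH] l r u /=; first by rewrite divr_gt0 ?part_sum_gt0.
by case: r => [|r]//; rewrite mulr_gt0// divr_gt0 ?expR_gt0 ?Zsum_gt0.
Qed.

Lemma block_rec_sum l r u w : \sum_a block_rec l r u (rcons w a) = block_rec l r u w.
Proof.
elim: w l r u => [|b w IH] l [|r] u //=; last 2 first.
- by rewrite mulr_suml; apply: eq_bigr => a _; rewrite size_rcons addnS.
- by rewrite -mulr_sumr IH.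
- rewrite -mulr_sumr -mulr_suml/= (_ : \sum_i _ = Zsum (l 0%N + 1)) ?addn1//.
  by rewrite divff ?mulr1 ?add0n// gt_eqF// Zsum_gt0.
Qed.

Lemma weights_block_weight l : weights (block_weight l).
Proof.
split=> [|w|w]; last exact: block_rec_sum.
- exact: expR_div_Zsum0.
- exact/ltW/block_rec_gt0.
Qed.

Lemma block_weight_cat l b w : size b = (l 0%N).+1 ->
  block_weight l (b ++ w) = expR (birkhoff psi (size b) (hat R b)) / Zsum (size b) *
    block_weight (fun i => l i.+1) w.
Proof.
(* Reading the rest [v] of a block closes it. [block_weight] itself starts from a completed empty
   block, whose factor is 1 by [expR_div_Zsum0], so what follows a block is again a
   [block_weight]. *)
have flush l' u v : block_rec l' (size v) u (v ++ w) =
    part_sum 0 (u ++ v) / Zsum (size (u ++ v)) * block_weight l' w.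
  elim: v u => [|a v IH] u /=; last by rewrite IH cat_rcons.
  rewrite cats0; case: w => [|a w']; last first.
    by rewrite /block_weight/= expR_div_Zsum0 mul1r.
  by rewrite [block_weight _ _]expR_div_Zsum0 mulr1.
case: b => // a b [sb]; rewrite {1}/block_weight/= expR_div_Zsum0 mul1r.
by rewrite -sb flush.
Qed.

Fixpoint block_end (l : nat -> nat) i : nat :=
  if i is i'.+1 then ((l 0).+1 + block_end (fun j => l j.+1) i')%N else 0%N.

Lemma block_endS l i : block_end l i.+1 = (block_end l i + (l i).+1)%N.
Proof.
elim: i l => [|i IH] l; first by rewrite /= addn0.
by rewrite -[LHS]/((l 0).+1 + block_end (fun j => l j.+1) i.+1)%N IH addnA.
Qed.

Lemma block_weight_anti l x m n : (m <= n)%N ->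
  block_weight l (mkseq x n) <= block_weight l (mkseq x m).
Proof.
have hl := weights_block_weight l.
move=> /subnKC <-; elim: (n - m)%N => [|j IH]; first by rewrite addn0.
apply: le_trans IH; rewrite addnS mkseqS -(weight_sum hl (mkseq x _)).
by rewrite (bigD1 (x (m + j)%N))//= lerDl sumr_ge0// => a _; exact: weight_ge0.
Qed.

Variables (e C : R).
Hypothesis osc : forall n x y, cylinder x n y ->
  `|birkhoff psi n x - birkhoff psi n y| <= n%:R * e + C.

(** At block ends the logarithm is a sum over blocks. A block of length [n] costs [n * e + C] for
    replacing the point by the padded block, and [n * e' + C'] for replacing [ln (Zsum n)] by
    [n * Q]. *)
Lemma block_weight_end l (Q e' C' : R) :
  (forall j, `|ln (Zsum (l j).+1) - (l j).+1%:R * Q| <= (l j).+1%:R * e' + C') ->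
  forall i x, let N := block_end l i in
  `|ln (block_weight l (mkseq x N)) + N%:R * Q - birkhoff psi N x|
    <= N%:R * (e + e') + i%:R * (C + C').
Proof.
move=> hZ i; elim: i l hZ => [|i IH] l hZ x /=.
  rewrite (weight1 (weights_block_weight l)) ln1 /birkhoff big_ord0 !mul0r.
  by rewrite subr0 !addr0 normr0.
set n := (l 0%N).+1; set N := block_end _ i.
rewrite (@mkseqD R k x) block_weight_cat ?size_mkseq//.
rewrite lnM ?posrE ?divr_gt0 ?expR_gt0 ?Zsum_gt0 ?block_rec_gt0//.
rewrite ln_div ?posrE ?expR_gt0 ?Zsum_gt0// expRK birkhoffD.
have := IH (fun j => l j.+1) (fun j => hZ j.+1) (iter n (@left_shift R k) x); rewrite -/N /=.
have cx : cylinder x n (hat R (mkseq x n)).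
  by apply/mkseq_cylinder; have := mkseq_hat R (mkseq x n); rewrite size_mkseq.
have := osc cx; have := hZ 0%N; rewrite -/n natrD -natr1.
set s1 := birkhoff psi n (hat R _); set s2 := birkhoff psi n x.
set s3 := birkhoff psi N _; set b := ln (block_weight _ _); set z := ln (Zsum n).
rewrite !ler_norml => /andP[z1 z2] /andP[s21 s22] /andP[b1 b2].
by apply/andP; split; lra.
Qed.

(** Inside a block the weight, which decreases with [N], lies between its values at the two block
    ends; moving to an end changes the other terms by at most the block length times a constant. *)
Lemma block_weight_bound l (Q e' C' M : R) :
  (forall j, `|ln (Zsum (l j).+1) - (l j).+1%:R * Q| <= (l j).+1%:R * e' + C') ->
  (forall x, `|psi x| <= M) ->
  0 <= e -> 0 <= e' -> 0 <= C -> 0 <= C' ->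
  forall i N x, (block_end l i <= N <= block_end l i.+1)%N ->
  `|ln (block_weight l (mkseq x N)) + N%:R * Q - birkhoff psi N x|
    <= N%:R * (e + e') + i.+1%:R * (C + C') + (l i).+1%:R * (M + `|Q| + e + e').
Proof.
move=> hZ hM e0 e'0 C0 C'0 i N x /andP[iN Ni].
have lnb w : 0 < block_weight l w by exact: block_rec_gt0.
have up : ln (block_weight l (mkseq x N)) <= ln (block_weight l (mkseq x (block_end l i))).
  by rewrite ler_ln ?posrE// block_weight_anti.
have lo : ln (block_weight l (mkseq x (block_end l i.+1))) <= ln (block_weight l (mkseq x N)).
  by rewrite ler_ln ?posrE// block_weight_anti.
have M0 : 0 <= M by exact: le_trans (hM x).
have tail m n : (m <= n)%N -> (n <= m + (l i).+1)%N ->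
    `|(n%:R * Q - birkhoff psi n x) - (m%:R * Q - birkhoff psi m x)| <=
    (l i).+1%:R * (M + `|Q|).
  move=> mn nm; rewrite -(subnKC mn) birkhoffD natrD.
  rewrite (_ : _ - _ = (n - m)%:R * Q -
    birkhoff psi (n - m) (iter m (@left_shift R k) x)); last by ring.
  rewrite (le_trans (ler_normB _ _))// (le_trans (lerD (lexx _) (birkhoff_bound hM _ _)))//.
  by rewrite normrM normr_nat -mulrDr addrC ler_wpM2r ?addr_ge0// ler_nat leq_subLR.
have := block_weight_end hZ i x; have := block_weight_end hZ i.+1 x.
cbv zeta; move: up lo.
have iNR : (block_end l i)%:R <= N%:R :> R by rewrite ler_nat.
have NiR : (block_end l i.+1)%:R <= N%:R + (l i).+1%:R :> R.
  by rewrite -natrD ler_nat block_endS leq_add2r.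
have := tail _ _ iN; rewrite -block_endS => /(_ Ni).
have := tail _ _ Ni; rewrite {1}block_endS leq_add2r => /(_ iN).
have := ler_wpM2r (addr_ge0 e0 e'0) iNR; have := ler_wpM2r (addr_ge0 e0 e'0) NiR.
move: (block_end l i.+1) (block_end l i) => N2 N1.
move: (ln _) (ln _) (ln _) (birkhoff _ N2 _) (birkhoff _ N1 _) (birkhoff _ N _) => p p1 p2 S2 S1 S.
rewrite -[i.+1%:R]natr1 !ler_norml => n2 n1 /andP[t1 t2] /andP[t3 t4] up lo.
move=> /andP[b1 b2] /andP[b3 b4].
have C2 : 0 <= C + C' by rewrite addr_ge0.
have le0 : 0 <= (l i).+1%:R * (e + e') by rewrite mulr_ge0 ?addr_ge0.
by apply/andP; split; lra.
Qed.

End block_weights.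

(** * Averaging weights over shifts *)

Section weight_shift.
Context (R : realType) (k : nat).
Local Notation A := 'I_k.+1.
Local Notation X := (fullshift R k).
Implicit Types p q : seq A -> R.

(** The weights of the image of the measure under the shift. *)
Definition weight_shift p (w : seq A) : R := \sum_a p (a :: w).

Lemma weights_shift p : weights p -> weights (weight_shift p).
Proof.
move=> [p1 p0 ps]; split=> [|w|w]; first by rewrite -p1 -(ps [::]).
  by rewrite sumr_ge0.
by rewrite exchange_big/=; apply: eq_bigr => a _; rewrite -ps.
Qed.

Lemma weights_iter_shift p j : weights p -> weights (iter j weight_shift p).
Proof. by move=> hp; elim: j => //= j; exact: weights_shift. Qed.

(** The first [n] letters are independent of the rest, so summing them out leaves [q] times their
    total weight, which is 1. *)
Lemma weight_shift_period p q n : weights p -> 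
  (forall b w, size b = n -> p (b ++ w) = p b * q w) -> iter n weight_shift p = q.
Proof.
move=> hp H; have -> : q = fun w => iter n weight_shift p [::] * q w.
  by apply/funext => w; rewrite (weight1 (weights_iter_shift n hp)) mul1r.
apply/funext => w; elim: n p {hp} H => [|n IH] p H; first by rewrite /= -[w]cat0s H.
rewrite !iterSr IH// => b v bn; rewrite /weight_shift mulr_suml.
by apply: eq_bigr => a _; rewrite -cat_cons H//= bn.
Qed.

Definition weight_average p n (w : seq A) : R :=
  n.+1%:R^-1 * \sum_(j < n.+1) iter j weight_shift p w.

Lemma weights_average p n : weights p -> weights (weight_average p n).
Proof.
move=> hp; have hj j := weights_iter_shift j hp; split=> [|w|w].
- rewrite /weight_average (eq_bigr (fun=> 1)) => [|j _]; last exact: weight1.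
  by rewrite sumr_const card_ord mulVf.
- by rewrite mulr_ge0// sumr_ge0// => j _; exact: weight_ge0.
- rewrite -mulr_sumr; congr (_ * _); rewrite exchange_big/=.
  by apply: eq_bigr => j _; exact: weight_sum.
Qed.

(** The shift permutes the [n.+1] terms of the average cyclically. *)
Lemma weight_average_invariant p n w : iter n.+1 weight_shift p = p ->
  \sum_a weight_average p n (a :: w) = weight_average p n w.
Proof.
move=> pn; rewrite -mulr_sumr; congr (_ * _); rewrite exchange_big/=.
rewrite big_ord_recr/= [RHS]big_ord_recl/= addrC; congr (_ + _).
by rewrite -[in RHS]pn.
Qed.

End weight_shift.

(** * Blocks of constant length and the pressure *)

Section variational_principle.
Context (R : realType) (k : nat).
Local Notation A := 'I_k.+1.
Local Notation X := (fullshift R k).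
Variables (psi : X -> R) (cpsi : continuous psi).
Variables (e C : R) (e0 : 0 <= e) (C0 : 0 <= C).
Hypothesis osc : forall n x y, cylinder x n y ->
  `|birkhoff psi n x - birkhoff psi n y| <= n%:R * e + C.
Variable n : nat.

Let p := block_weight psi (fun=> n).
Let Q := n.+1%:R^-1 * ln (Zsum psi n.+1).
Let d := e + C / n.+1%:R.

Lemma weights_block_constant : weights p.
Proof. exact: weights_block_weight. Qed.

Lemma block_constant_gt0 w : 0 < p w.
Proof. exact: block_rec_gt0. Qed.

Lemma block_end_constant i : block_end (fun=> n) i = (i * n.+1)%N.
Proof. by elim: i => //= i ->; rewrite mulSn. Qed.

(** Among [N] letters there are about [N / n.+1] blocks, so the loss [C] per block amounts to
    [C / n.+1] per letter; together with [e] this makes [d]. *)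
Lemma block_constant_bound : exists c, forall x N,
  `|ln (p (mkseq x N)) + N%:R * Q - birkhoff psi N x| <= N%:R * d + c.
Proof.
have [M _ hM] := continuous_bounded cpsi.
exists (C + n.+1%:R * (M + `|Q| + e + 0)) => x N.
have hZ (j : nat) : `|ln (Zsum psi n.+1) - n.+1%:R * Q| <= n.+1%:R * 0 + 0.
  by rewrite /Q mulrA divff// mul1r subrr normr0 mulr0 addr0.
have Ni : (block_end (fun=> n) (N %/ n.+1) <= N <= block_end (fun=> n) (N %/ n.+1).+1)%N.
  by rewrite !block_end_constant leq_divM ltnW// ltn_ceil.
apply: (le_trans (block_weight_bound osc hZ hM e0 (lexx _) C0 (lexx _) x Ni)).
rewrite !addr0 addrA lerD2r /d mulrDr -addrA lerD2l -natr1 mulrDl mul1r lerD2r.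
rewrite mulrCA mulrC ler_wpM2l// ler_pdivlMr// -natrM ler_nat.
exact: leq_divM.
Qed.

Let bound_stable (q : seq A -> R) := exists B : R, 0 < B /\
  forall x N, q (mkseq x N) <= B * expR (- (N%:R * Q) + birkhoff psi N x + N%:R * d).

(** Prepending a letter changes the exponent by a bounded amount, and there are [k.+1] letters to
    sum over; only the constant grows. *)
Lemma bound_stable_shift q : bound_stable q -> bound_stable (weight_shift q).
Proof.
move=> [B [B0 qB]]; have [M _ hM] := continuous_bounded cpsi.
exists (B * expR (`|Q| + M + d) * k.+1%:R); split; first by rewrite !mulr_gt0 ?expR_gt0.
move=> x N; rewrite /weight_shift.
apply: (@le_trans _ _ (\sum_(a < k.+1) B * (expR (`|Q| + M + d) *
    expR (- (N%:R * Q) + birkhoff psi N x + N%:R * d)))).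
  apply: ler_sum => a _; rewrite -(@mkseq_xcons R) (le_trans (qB _ _))// ler_pM2l//.
  rewrite -expRD ler_expR birkhoffS left_shift_xcons -natr1.
  have := hM (xcons a x); rewrite ler_norml => /andP[_ h1].
  have := ler_norm (- Q); rewrite normrN => h2; lra.
by rewrite sumr_const card_ord -[leLHS]mulr_natr mulrA -mulrA [X in _ * X]mulrC mulrA.
Qed.

Lemma exists_invariant_measure : exists2 mu : probability X R, shift_invariant mu &
  ((Q - d)%:E <= free_energy (birkhoff psi) mu)%E.
Proof.
have hp := weights_block_constant; have hm := weights_average n hp.
(* All blocks have length [n.+1] and the same law, so dropping the first one leaves the same
   process. *)
have per : iter n.+1 (@weight_shift R k) p = p.
  apply: (weight_shift_period hp) => b w bn.
  rewrite -[b in RHS]cats0 /p !block_weight_cat ?bn//.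
  by rewrite (weight1 (weights_block_weight _ _)) mulr1.
pose mu := weight_measure hm.
have muE x N : mu (cylinder x N) = (weight_average p n (mkseq x N))%:E.
  exact: weight_measure_cylinder.
have inv : shift_invariant mu.
  by apply: (shift_invariant_weights muE) => w; exact: weight_average_invariant.
exists mu => //.
have [B [B0 mB]] : bound_stable (weight_average p n).
  have bp j : bound_stable (iter j (@weight_shift R k) p).
    elim: j => [|j]; last exact: bound_stable_shift.
    have [c pc] := block_constant_bound; exists (expR c); split; first exact: expR_gt0.
    move=> x N; rewrite -expRD -[leLHS]lnK ?posrE ?block_constant_gt0//= ler_expR.
    have := pc x N; rewrite ler_norml => /andP[_]; lra.
  have /choice[B BP] := bp; exists (\sum_(j < n.+1) B j); split.
    rewrite big_ord_recl/= ltr_wpDr//; last by case: (BP 0%N).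
    by apply: sumr_ge0 => j _; apply: ltW; case: (BP (bump 0 j)).
  move=> x N; rewrite /weight_average mulr_suml.
  apply: (@le_trans _ _ (\sum_(j < n.+1) iter j (@weight_shift R k) p (mkseq x N))).
    rewrite ler_piMl//.
      by apply: sumr_ge0 => j _; exact: weight_ge0 (weights_iter_shift _ hp) _.
    by rewrite invf_le1// ler1n.
  by apply: ler_sum => j _; case: (BP j) => _; apply.
apply: (free_energy_lower cpsi inv _ (c := ln B)) => [x N|x N].
  rewrite muE/= /weight_average mulr_gt0 ?invr_gt0// big_ord_recl/= ltr_wpDr//.
    by apply: sumr_ge0 => j _; exact: (weight_ge0 (weights_iter_shift (bump 0 j) hp)).
  exact: block_constant_gt0.
rewrite muE/= (le_trans (mB x N))// -{1}(lnK B0) -expRD ler_expR; lra.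
Qed.

(** [free_energy_upper] against the block measure and [exists_invariant_measure] place the pressure
    between [Q - d] and [Q + d]; multiplying by [n.+1] gives the bound. *)
Lemma Zsum_top_pressure :
  `|ln (Zsum psi n.+1) - n.+1%:R * top_pressure psi| <= n.+1%:R * e + C.
Proof.
have up : (pressure (birkhoff psi) <= (Q + d)%:E)%E.
  apply: ub_ereal_sup => _ [mu inv <-].
  have [c pc] := block_constant_bound.
  apply: (@free_energy_upper _ _ _ cpsi mu
    (weight_measure weights_block_constant) Q d c inv) => x N.
  rewrite weight_measure_cylinder/= -[leRHS]lnK ?posrE ?block_constant_gt0// ler_expR.
  have := pc x N; rewrite ler_norml => /andP[+ _]; lra.
have [mu inv lo] := exists_invariant_measure.
have {}lo : ((Q - d)%:E <= pressure (birkhoff psi))%E.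
  by apply: le_trans lo _; apply: ereal_sup_ubound; exists mu.
have : `|Q - top_pressure psi| <= d.
  (* Both bounds are finite, so the pressure is a real number and [fine] does not return its
     default. *)
  rewrite /top_pressure; case: (pressure _) up lo => [P| |]//=; rewrite !lee_fin.
  by rewrite ler_norml => h1 h2; apply/andP; split; lra.
move=> H; have -> : ln (Zsum psi n.+1) = n.+1%:R * Q by rewrite /Q mulrA divff// mul1r.
rewrite -mulrBr normrM ger0_norm// (le_trans (ler_wpM2l _ H))//.
by rewrite /d mulrDr mulrCA divff// mulr1.
Qed.

End variational_principle.

(** * Construction of a weak Gibbs measure *)

Section subexponential_gibbs.
Context (R : realType) (k : nat).
Local Notation X := (fullshift R k).
Variables (psi : X -> R) (cpsi : continuous psi).
Implicit Type nu : probability X R.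

Definition gibbs_error nu n x : R := ln (fine (nu (cylinder x n))) +
  n%:R * top_pressure psi - birkhoff psi n x.

Definition subexponential_gibbs nu : Prop :=
  (forall x n, 0 < fine (nu (cylinder x n))) /\
  forall e : R, 0 < e -> exists C, forall n x, `|gibbs_error nu n x| <= n%:R * e + C.

(** Blocks of lengths 1, 2, 3, ... end at the triangular numbers; doubling avoids a division. *)
Lemma block_end_idfun i : ((block_end idfun i).*2 = i * i.+1)%N.
Proof. by elim: i => // i IH; rewrite block_endS doubleD IH (mulnC i) -muln2 -mulnDr addn2. Qed.

(* Independent blocks of lengths 1, 2, 3, ...: the number of blocks met before
   time n and the length of the current one are both O(sqrt n). *)
Lemma exists_subexponential_gibbs : exists nu, subexponential_gibbs nu.
Proof.
pose p := block_weight psi idfun.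
have hp : weights p by exact: weights_block_weight.
exists (weight_measure hp); split.
  by move=> x n; rewrite weight_measure_cylinder; exact: block_rec_gt0.
move=> e e0; have e3 : 0 < e / 3 by rewrite divr_gt0.
have [C C0 osc] := birkhoff_oscillation cpsi e3.
have [M M0 hM] := continuous_bounded cpsi.
(* [B] collects the constants of [block_weight_bound], where the number of blocks and the length of
   the current one are both [i.+1]. *)
set P := top_pressure psi; pose B := (C + C) + (M + `|P| + e / 3 + e / 3).
have B0 : 0 <= B by rewrite !addr_ge0// ltW.
exists ((6 * B / e + 1) * B) => n x.
have [i /andP[iN Ni]] : exists i, (block_end idfun i <= n <= block_end idfun i.+1)%N.
  have ex : exists i, (n <= block_end idfun i)%N.
    by exists n; rewrite -leq_double block_end_idfun -muln2 leq_mul2l; case: n.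
  case: (ex_minnP ex) => -[|i] ni imin.
    by exists 0%N; rewrite /= (leq_trans ni).
  exists i; rewrite ni andbT leqNgt; apply/negP => /ltnW/imin.
  by rewrite ltnn.
have hZ j := Zsum_top_pressure cpsi (ltW e3) C0 osc (idfun j).
have iNi : (block_end idfun i <= n <= block_end idfun i.+1)%N by rewrite iN.
have := block_weight_bound osc hZ hM (ltW e3) (ltW e3) C0 C0 x iNi.
rewrite /gibbs_error weight_measure_cylinder -/p -/P/= => /le_trans; apply.
rewrite (_ : _ + _ + _ = n%:R * (2 / 3 * e) + i.+1%:R * B); last by rewrite /B; field.
have nR : (i%:R + 1) * i%:R <= 2 * n%:R :> R.
  rewrite natr1 -!natrM ler_nat mulnC -block_end_idfun mul2n leq_double//.
rewrite -[i.+1%:R]natr1; have i0 : 0 <= i%:R :> R by [].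
have n0 : 0 <= n%:R :> R by [].
(* For large [i], the relation [(i + 1) * i <= 2 * n] absorbs [(i + 1) * B] into [n * e / 3]; for
   [i] below the threshold the additive constant covers it. *)
have [Bi|iB] := leP (6 * B / e) i%:R.
  have {}Bi : 6 * B <= i%:R * e by rewrite -ler_pdivrMr.
  have := ler_wpM2l (addr_ge0 i0 ler01) Bi.
  have := ler_wpM2r (ltW e0) nR.
  have : 0 <= (6 * B / e + 1) * B by rewrite mulr_ge0// addr_ge0// divr_ge0 ?mulr_ge0// ltW.
  set W := (_ + 1) * B; lra.
have := ler_wpM2r B0 (lerD (ltW iB) (lexx 1)).
have := mulr_ge0 n0 (ltW e0); set W := (_ / e + 1) * B; lra.
Qed.

Section weak_gibbs_of_subexponential.
Variable nu : probability X R.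
Hypothesis hnu : subexponential_gibbs nu.

(** Finite by [hnu]; it becomes the logarithm of the constant [K n] of [weak_gibbs]. *)
Definition gibbs_error_sup n : R := sup [set `|gibbs_error nu n x| | x in setT].

Lemma gibbs_error_le n x : `|gibbs_error nu n x| <= gibbs_error_sup n.
Proof.
apply: ub_le_sup; last by exists x.
by have [C hC] := (proj2 hnu) 1 ltr01; exists (n%:R * 1 + C) => _ [y _ <-].
Qed.

Lemma gibbs_error_sup_ge0 n : 0 <= gibbs_error_sup n.
Proof. exact: le_trans (normr_ge0 _) (gibbs_error_le n point). Qed.

Lemma gibbs_error_sup_cvg : n%:R^-1 * gibbs_error_sup n @[n --> \oo] --> 0.
Proof.
apply/cvgrPdist_le => e e0; have e2 : 0 < e / 2 by rewrite divr_gt0.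
have [C hC] := (proj2 hnu) _ e2; near=> n.
have n0 : 0 < n%:R :> R by rewrite ltr0n; near: n; exists 1%N.
have Ce : n%:R^-1 * C <= e / 2 by near: n; exact: near_divn_le.
rewrite sub0r normrN ger0_norm ?mulr_ge0 ?invr_ge0 ?gibbs_error_sup_ge0//.
apply: (@le_trans _ _ (n%:R^-1 * (n%:R * (e / 2) + C))).
  rewrite ler_pM2l ?invr_gt0//; apply: ge_sup; first by exists `|gibbs_error nu n point|, point.
  by move=> _ [x _ <-].
by rewrite mulrDr mulKf ?gt_eqF// [leRHS](splitr e) lerD2l.
Unshelve. all: by end_near. Qed.

Lemma weak_gibbs_of_subexponential : weak_gibbs psi nu.
Proof.
exists (fun n => expR (gibbs_error_sup n)); split=> [n _||x n _].
- by rewrite -expR0 ler_expR gibbs_error_sup_ge0.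
- by under eq_fun do rewrite expRK; exact: gibbs_error_sup_cvg.
have := gibbs_error_le n x; have := (proj1 hnu) x n.
rewrite /gibbs_error; set m := fine _ => m0.
rewrite -{2 3}(lnK m0) -expRB -expRN !ler_expR ler_norml => /andP[h1 h2].
by apply/andP; split; lra.
Qed.

End weak_gibbs_of_subexponential.

End subexponential_gibbs.

(** * Sequences of functions *)

Section sequences.
Context (R : realType) (k : nat).
Local Notation X := (fullshift R k).
Implicit Types (F G : nat -> X -> R) (f g phi psi u : X -> R).

Lemma supnorm_ge0 f : (0 <= supnorm f)%E.
Proof.
apply: (@le_trans _ _ `|f point|%:E); first by rewrite lee_fin.
by apply: ereal_sup_ubound; exists point.
Qed.

Lemma supnorm_le f (b : \bar R) : (forall x, (`|f x|%:E <= b)%E) -> (supnorm f <= b)%E.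
Proof. by move=> fb; apply: ub_ereal_sup => _ [x _ <-]. Qed.

Lemma le_supnorm f x : (`|f x|%:E <= supnorm f)%E.
Proof. by apply: ereal_sup_ubound; exists x. Qed.

Lemma average_supnorm_ge0 f n : (0 <= n%:R^-1%:E * supnorm f)%E.
Proof. by rewrite mule_ge0 ?supnorm_ge0// lee_fin invr_ge0. Qed.

Lemma physically_equivalent_near F G (b : nat -> R) :
  (forall n x, `|F n x - G n x| <= b n) -> n%:R^-1 * b n @[n --> \oo] --> 0 ->
  physically_equivalent F G.
Proof.
move=> FGb b0; apply: (@squeeze_cvge _ _ _ _ (fun=> 0%E) _ (fun n => (n%:R^-1 * b n)%:E)).
- apply: nearW => n; rewrite average_supnorm_ge0/= EFinM lee_wpmul2l//.
  by apply: supnorm_le => x; rewrite lee_fin; exact: FGb.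
- exact: cvg_cst.
- by apply: cvg_EFin; [exact: nearW|exact: b0].
Qed.

Lemma physically_equivalent_trans F G1 G2 :
  physically_equivalent F G1 -> physically_equivalent F G2 ->
  physically_equivalent G1 G2.
Proof.
move=> h1 h2; have D0 : ((0 : \bar R) +? 0)%E by [].
have := cvgeD D0 h1 h2; rewrite adde0 => h.
apply: (@squeeze_cvge _ _ _ _ (fun=> 0%E) _ (fun n => n%:R^-1%:E * supnorm (F n \- G1 n)%R +
  n%:R^-1%:E * supnorm (F n \- G2 n)%R)%E); [|exact: cvg_cst|exact: h].
apply: nearW => n; rewrite average_supnorm_ge0/= -ge0_muleDr ?supnorm_ge0// lee_wpmul2l//.
apply: supnorm_le => x.
apply: (@le_trans _ _ (`|F n x - G1 n x|%:E + `|F n x - G2 n x|%:E)%E).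
  rewrite -EFinD lee_fin distrC.
  rewrite (_ : G2 n x - G1 n x = (F n x - G1 n x) - (F n x - G2 n x)); last by ring.
  exact: ler_normB.
by apply: leeD; [exact: (le_supnorm (F n \- G1 n))|exact: (le_supnorm (F n \- G2 n))].
Qed.

Lemma asymptotically_additive_of_equivalent F psi :
  physically_equivalent F (birkhoff psi) -> asymptotically_additive F.
Proof.
move=> h e e0; exists psi; rewrite is_cvg_limn_esupE; last by apply/cvg_ex; exists 0%E.
by rewrite (cvg_lim _ h)// lte_fin.
Qed.

(** Telescoping: [birkhoff u j (left_shift x) - birkhoff u j x] equals
    [u (iter j left_shift x) - u x]; average over [j < n]. *)
Lemma coboundary_average u n x : (0 < n)%N ->
  u x - coboundary (fun y => - (n%:R^-1 * \sum_(j < n) birkhoff u j y)) x =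
  n%:R^-1 * birkhoff u n x.
Proof.
move=> n0; have n0R : n%:R != 0 :> R by rewrite pnatr_eq0 -lt0n.
rewrite /coboundary opprK.
have -> : u x = n%:R^-1 * (\sum_(j < n) u x).
  by rewrite sumr_const card_ord -[u x *+ n]mulr_natl mulKf.
rewrite opprD opprK addrA -mulrDr -mulrBr -big_split/= -sumrB; congr (_ * _).
apply: eq_bigr => j _.
have := birkhoffS u j x; have := birkhoffD u j 1 x; rewrite addn1 => ->.
by rewrite [birkhoff u 1 _]big_ord1/= => h; lra.
Qed.

(** By [coboundary_average], the distance from [psi \- phi] to the chosen coboundaries is the norm
    of the averaged Birkhoff sums, which tends to 0 by hypothesis. *)
Lemma Wcob_of_equivalent phi psi : continuous phi -> continuous psi ->
  physically_equivalent (birkhoff psi) (birkhoff phi) -> Wcob (psi \- phi).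
Proof.
move=> cphi cpsi h; set u := psi \- phi.
have cu : continuous u by move=> x; apply: (@continuousB _ _ _ psi phi x (cpsi x) (cphi x)).
have Bu n x : birkhoff u n x = birkhoff psi n x - birkhoff phi n x.
  by rewrite /birkhoff -sumrB.
exists (fun n y => - (n%:R^-1 * \sum_(j < n) birkhoff u j y)).
  move=> n x.
  have cs m : continuous (fun y => \sum_(j < m) birkhoff u j y).
    elim: m => [|m IH] y.
      rewrite (_ : (fun _ => _) = cst 0); first exact: cst_continuous.
      by apply/funext => z; rewrite big_ord0.
    rewrite (_ : (fun _ => _) = (fun z => \sum_(j < m) birkhoff u j z) \+ birkhoff u m).
      by apply: continuousD; [exact: IH|exact: continuous_birkhoff].
    by apply/funext => z; rewrite big_ord_recr.
  rewrite (_ : (fun _ => _) = cst (- n%:R^-1) \* (fun y => \sum_(j < n) birkhoff u j y)).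
    by apply: continuousM; [exact: cst_continuous|exact: cs].
  by apply/funext => z; rewrite /= mulNr.
apply: (squeeze_cvge _ (cvg_cst 0%E) h).
near=> n; have n0 : (0 < n)%N by near: n; exists 1%N.
rewrite supnorm_ge0/=; apply: supnorm_le => x.
rewrite /= coboundary_average// normrM ger0_norm ?invr_ge0// EFinM lee_wpmul2l//.
by rewrite Bu; exact: (le_supnorm (birkhoff psi n \- birkhoff phi n)).
Unshelve. all: by end_near. Qed.

End sequences.

(** * Cylindrical sequences and Bowen generators *)

Section generators.
Context (R : realType) (k : nat).
Local Notation X := (fullshift R k).
Implicit Types (f phi psi : X -> R) (F : nat -> X -> R).

(** Distance below [2 ^- 1] means equality of the letters numbered 0; along [n] iterates this gives
    [n] common letters. *)
Lemma orbit_close_cylinder n (x y : X) :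
  (forall j, (j < n)%N ->
     mdist (iter j (@left_shift R k) x) (iter j (@left_shift R k) y) < (2 ^- 1 : R)) ->
  cylinder x n y.
Proof.
move=> H j jn; have /mdist_lt_cylinder/(_ 0%N erefl) := H j jn.
by rewrite !iter_shift !addn0.
Qed.

Definition cylindrical F : Prop :=
  forall n x y, (0 < n)%N -> cylinder x n y -> F n x = F n y.

Lemma cylindrical_walters F : cylindrical F -> walters F.
Proof.
move=> cF kap kap0; exists (2 ^- 1) => // n x y n0 /orbit_close_cylinder xy.
by rewrite (cF n x y)// subrr normr0.
Qed.

Lemma cylindrical_bounded_variation F : cylindrical F -> has_bounded_variation F.
Proof.
move=> cF; exists (2 ^- 1) => //; exists 0 => n x y n0 /orbit_close_cylinder xy.
by rewrite (cF n x y)// subrr normr0.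
Qed.

Lemma cylindrical_continuous F n : (0 < n)%N -> cylindrical F -> continuous (F n).
Proof.
move=> n0 cF; apply/continuous_cylinderP => x e e0; exists n => y xy.
by rewrite (cF n x y)// subrr normr0.
Qed.

(** Points in different cylinders of length [n] are at distance at least [2 ^- n], so the bound
    [2 * M] on the difference yields exponent 1. *)
Lemma cylindrical_holder F n : (0 < n)%N -> cylindrical F -> holder_continuous (F n).
Proof.
move=> n0 cF; have [M M0 hM] := continuous_bounded (cylindrical_continuous n0 cF).
exists (2 * M * 2 ^+ n), 1; split => // [|x y]; first by rewrite !mulr_ge0// exprn_ge0.
rewrite powRr1 ?mdist_ge0//.
have [xy|nxy] := pselect (cylinder x n y).
  by rewrite (cF n x y)// subrr normr0 !mulr_ge0 ?mdist_ge0// exprn_ge0.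
have /negP : ~ (mdist x y < (2 ^- n : R)) by move/mdist_lt_cylinder.
rewrite -leNgt => dn.
apply: (@le_trans _ _ (2 * M)).
  by rewrite (le_trans (ler_normB _ _))// mulr2n mulrDl !mul1r lerD.
by rewrite -mulrA ler_peMr ?mulr_ge0// -ler_pdivrMl ?exprn_gt0// mulr1.
Qed.

Lemma locally_constant_Bow phi : locally_constant phi -> Bow phi.
Proof.
move=> lphi; have [N HN] := locally_constant_cylinder lphi; split.
  apply/continuous_cylinderP => x e e0; exists N => y xy.
  by rewrite (HN x y)// subrr normr0.
exists (2 ^- N); first by rewrite invr_gt0 exprn_gt0.
exists 0 => n x y _ H; rewrite /birkhoff -sumrB big1 ?normr0// => j _.
by rewrite (HN _ _ (proj1 (mdist_lt_cylinder _ _ _) (H j (ltn_ord j)))) subrr.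
Qed.

Lemma holder_cylinder phi : holder_continuous phi -> exists C r : R,
  [/\ 0 <= C, 0 < r, r < 1 &
    forall n x y, cylinder x n y -> `|phi x - phi y| <= C * r ^+ n].
Proof.
move=> [C [a [C0 a0 a1 H]]]; exists C, (2^-1 `^ a); split=> // [|n x y xy].
- have h2 : (2^-1 : R) < 1 by rewrite invf_lt1// ltr1n.
  have := @gt0_ltr_powR R a a0 2^-1 1; rewrite powR1; apply=> //; rewrite nnegrE.
    by rewrite invr_ge0.
  exact: ler01.
rewrite (le_trans (H x y))// ler_wpM2l//.
rewrite -powR_mulrn ?powR_ge0// -powRrM mulrC powRrM powR_mulrn ?invr_ge0//.
rewrite exprVn ge0_ler_powR ?(ltW a0) ?nnegrE ?mdist_ge0 ?invr_ge0 ?exprn_ge0//.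
by apply/ltW/mdist_lt_cylinder.
Qed.

Lemma holder_Bow phi : holder_continuous phi -> Bow phi.
Proof.
move=> /holder_cylinder[C [r [C0 r0 r1 H]]]; split.
  apply/continuous_cylinderP => x e e0.
  have /cvgrPdist_lt/(_ (e / (C + 1))) : r ^+ n @[n --> \oo] --> 0.
    by apply: cvg_expr; rewrite ger0_norm// ltW.
  rewrite divr_gt0 ?ltr_wpDl// => /(_ isT)[n _ /(_ n (leqnn n))].
  rewrite /= sub0r normrN ger0_norm ?exprn_ge0 ?ltW// => rn.
  exists n => y /H/le_lt_trans; apply.
  rewrite (@le_lt_trans _ _ ((C + 1) * r ^+ n))//.
    by rewrite ler_wpM2r ?exprn_ge0 ?ltW// ltrDl.
  by rewrite -ltr_pdivlMl ?ltr_wpDl// mulrC.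
exists (2 ^- 1) => //; exists (C / (1 - r)) => n x y _ /orbit_close_cylinder xy.
have r1' : 0 < 1 - r by rewrite subr_gt0.
(* The new bound is the geometric sum of [C * r ^+ j] over [j < n], a form that passes through the
   induction. *)
suff : `|birkhoff phi n x - birkhoff phi n y| <= C / (1 - r) * (1 - r ^+ n).
  move/le_trans; apply; rewrite ler_piMr ?divr_ge0 ?(ltW r1')//.
  by rewrite gerBl exprn_ge0 ?ltW.
elim: n x y xy => [|n IH] x y xy.
  by rewrite /birkhoff !big_ord0 subrr normr0 expr0 subrr mulr0.
have h1 := H _ _ _ xy; have h2 := IH _ _ (@cylinder_shift _ _ _ _ n n.+1 1 xy (leqnn _)).
rewrite !birkhoffS opprD addrACA (le_trans (ler_normD _ _))// (le_trans (lerD h1 h2))//.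
have -> : C / (1 - r) * (1 - r ^+ n.+1) =
    C * r ^+ n + C / (1 - r) * (1 - r ^+ n).
  by rewrite exprS; field; rewrite gt_eqF.
rewrite lerD2r ler_wpM2l// exprS ler_piMl ?exprn_ge0 ?ltW//.
Qed.

End generators.

(** * Transfer of equilibrium measures *)

Section equilibrium_transfer.
Context (R : realType) (k : nat).
Local Notation X := (fullshift R k).
Implicit Types (F G : nat -> X -> R).

Lemma pressure_eq F G :
  (forall mu, shift_invariant mu -> free_energy F mu = free_energy G mu) ->
  pressure F = pressure G.
Proof.
move=> FG; congr ereal_sup; apply/seteqP; split => _ [mu inv <-]; exists mu.
- exact: inv.
- exact: esym (FG mu inv).
- exact: inv.
- exact: FG mu inv.
Qed.

Lemma unique_equilibrium_measure_eq F G :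
  (forall mu, shift_invariant mu -> free_energy F mu = free_energy G mu) ->
  unique_equilibrium_measure F -> unique_equilibrium_measure G.
Proof.
move=> FG [mu [inv eqmu] uniq]; exists mu.
  split; first exact: inv.
  exact: etrans (esym (FG mu inv)) (etrans eqmu (pressure_eq FG)).
move=> mu' [inv' eqmu'] A mA; apply: (uniq mu' _ A mA); split; first exact: inv'.
exact: etrans (FG mu' inv') (etrans eqmu' (esym (pressure_eq FG))).
Qed.

End equilibrium_transfer.

Unset Implicit Arguments.

Theorem mainTheorem3 (R : realType) (k : nat) (psi : fullshift R k -> R)
    (hpsi : (Hof `&` coWB) psi) :
  (exists nu : probability (fullshift R k) R,
    weak_gibbs psi nu /\
    let f (n : nat) (x : fullshift R k) : R := ln (fine (nu (cylinder x n))) in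
    let G (n : nat) (x : fullshift R k) : R :=
      f n x + n%:R * top_pressure psi in
    (* (a) *)
    ([/\ asymptotically_additive G,
         physically_equivalent G (birkhoff psi),
         unique_equilibrium_measure G,
         walters G &
         has_bounded_variation G] /\
     (forall phi, Bow phi -> ~ physically_equivalent G (birkhoff phi)) /\
     (forall phi, locally_constant phi ->
        ~ physically_equivalent G (birkhoff phi))) /\
    (* (b) *)
    (forall alpha : R, 0 < alpha ->
      exists H : nat -> fullshift R k -> R,
        [/\ forall n, (0 < n)%N -> holder_continuous (H n),
            forall n, (0 < n)%N ->
              (supnorm (fun x => (H n x - f n x - n%:R * top_pressure psi)%R)
                 <= alpha%:E)%E,
            asymptotically_additive H,
            has_bounded_variation H &
            physically_equivalent H (birkhoff psi)] /\
        unique_equilibrium_measure H /\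
        (forall phi, Bow phi -> ~ physically_equivalent H (birkhoff phi)) /\
        (forall phi, holder_continuous phi ->
           ~ physically_equivalent H (birkhoff phi)))) /\
  (* The final consequence, for each of the readings "continuous" / "Holder
     continuous" of the terms and "Bowen" / "Holder" of the generator. *)
  (let every_equivalent (C D : set (fullshift R k -> R)) :=
     forall F : nat -> fullshift R k -> R,
       (forall n, (0 < n)%N -> C (F n)) ->
       asymptotically_additive F -> has_bounded_variation F ->
       unique_equilibrium_measure F ->
       exists2 phi, D phi & physically_equivalent F (birkhoff phi) in
   let cont := [set phi : fullshift R k -> R | continuous phi] in
   [/\ ~ every_equivalent cont Bow,
       ~ every_equivalent cont holder_continuous,
       ~ every_equivalent holder_continuous Bow &
       ~ every_equivalent holder_continuous holder_continuous]).
Proof.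
case: hpsi => -[cpsi _ upsi] [_ nWB].
have [nu hnu] := exists_subexponential_gibbs cpsi.
pose G n (x : fullshift R k) : R := ln (fine (nu (cylinder x n))) + n%:R * top_pressure psi.
have cylE n (x y : fullshift R k) : cylinder x n y -> cylinder x n = cylinder y n.
  by move=> xy; apply/seteqP; split => z; rewrite !mkseq_cylinder (proj1 (mkseq_cylinder _ _ _) xy).
have cG : cylindrical G by move=> n x y n0 /cylE xy; rewrite /G xy.
have Gpsi n x : `|G n x - birkhoff psi n x| <= gibbs_error_sup psi nu n.
  exact: (gibbs_error_le hnu n x).
have b0 := gibbs_error_sup_cvg hnu.
have peG : physically_equivalent G (birkhoff psi) by exact: physically_equivalent_near Gpsi b0.
have aaG := asymptotically_additive_of_equivalent peG.
have uG : unique_equilibrium_measure G.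
  apply: unique_equilibrium_measure_eq upsi => mu inv.
  rewrite free_energy_birkhoff//; apply/esym.
  apply: (free_energy_near cpsi inv _ _ b0) => // n n0.
  exact: continuous_bounded_measurable (cylindrical_continuous n0 cG).
have bvG := cylindrical_bounded_variation cG.
(* Otherwise [psi], as the sum of the weak coboundary [psi \- phi] and the Bowen function [phi],
   would lie in [WB]. *)
have nBow phi : Bow phi -> ~ physically_equivalent G (birkhoff phi).
  move=> bphi pe; apply: nWB; exists (psi \- phi), phi; split => //.
    apply: Wcob_of_equivalent => //; first by case: bphi.
    exact: physically_equivalent_trans peG pe.
  by apply/funext => x /=; rewrite subrK.
have hG n : (0 < n)%N -> holder_continuous (G n) by move=> n0; exact: cylindrical_holder.
have ctG n : (0 < n)%N -> continuous (G n) by move=> n0; exact: cylindrical_continuous.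
split.
  exists nu; split; first exact: weak_gibbs_of_subexponential.
  split.
    split; first by split => //; exact: cylindrical_walters.
    by split=> // phi /locally_constant_Bow; exact: nBow.
  move=> alpha alpha0; exists G; split.
    split=> // n n0; apply: supnorm_le => x.
    by rewrite (_ : _ - _ = 0) ?normr0 ?lee_fin ?ltW// /G; ring.
  by split=> //; split=> // phi /holder_Bow; exact: nBow.
(* [G] refutes all four versions: its terms are Hoelder and continuous, and a Hoelder generator is
   Bowen. *)
split=> /(_ G).
- by case=> // phi /nBow.
- by case=> // phi /holder_Bow/nBow.
- by case=> // phi /nBow.
- by case=> // phi /holder_Bow/nBow.
Qed.
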